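(* For each integer $i\ge 1$ let $q_i$ be the $i$-th prime congruent to $3$ modulo $4$, let $$S_i=\{n\in\mathbb{N} : n=q_i^4\nu^2 \text{ for some } \nu \text{ that is the product of exactly } i \text{ distinct primes } p\equiv 3 \bmod 4\},$$ and let $S=\bigcup_{i=1}^{\infty}S_i\subset\mathbb{N}$. Then $S$ has Property P, and its counting function $S(x)=\#\{n\in S: n<x\}$ satisfies $$S(x)\gg\frac{\sqrt{x}}{\sqrt{\log x}\,(\log\log x)^2(\log\log\log x)^2}.$$
   Context: A set $A$ of positive integers, with elements listed increasingly as $a_1<a_2<\cdots$, has Property P if $a_i\nmid a_j+a_k$ for all indices $i<j<k$; that is, no element of $A$ divides the sum of two larger (distinct) elements of $A$. The primes $q_i$ are enumerated increasingly ($q_1=3$, $q_2=7$, $q_3=11,\ldots$). In the definition of $S_i$, the prime $q_i$ itself is allowed to be one of the prime factors of $\nu$. The notation $f(x)\gg g(x)$ means that there is a constant $c>0$ such that $f(x)\ge c\,g(x)$ for all sufficiently large $x$. *)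

(* Defs.v *)
From mathcomp Require Import all_boot all_order all_algebra.
From mathcomp Require Import finmap.
From mathcomp Require Import all_classical all_reals all_analysis.

Set Implicit Arguments.
Unset Strict Implicit.
Unset Printing Implicit Defensive.

Import Order.TTheory GRing.Theory Num.Theory.

Local Open Scope nat_scope.

(** For [A] listed increasingly as [a_1 < a_2 < ...], the indices [i < j < k]
    correspond to elements [a < b < c]. *)
Definition property_P (A : set nat) : Prop :=
  (forall a, A a -> 0 < a) /\
  (forall a b c, A a -> A b -> A c -> a < b -> b < c -> ~~ (a %| b + c)).

Definition prime3mod4 (p : nat) : bool := prime p && (p %% 4 == 3).

Lemma prime3mod4_dvd m : m %% 4 = 3 -> exists2 p, prime3mod4 p & p %| m.
Proof.
have [n] := ubnP m; elim: n m => // n IHn m ltmn m3.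
have m_gt1 : 1 < m by case: m m3 {ltmn} => [|[|m]].
have p_pr := pdiv_prime m_gt1; have p_dvd := pdiv_dvd m.
have [p3|pN3] := boolP (pdiv m %% 4 == 3).
  by exists (pdiv m) => //; rewrite /prime3mod4 p_pr.
have mE := divnK p_dvd.
have k3 : (m %/ pdiv m) %% 4 = 3.
  move: m3 pN3; rewrite -{1}mE -modnMm.
  have := ltn_pmod (m %/ pdiv m) (isT : 0 < 4).
  have := ltn_pmod (pdiv m) (isT : 0 < 4).
  by move: (_ %% 4) (_ %% 4) => [|[|[|[|?]]]] // [|[|[|[|?]]]].
have [|q q3 q_dvd] := IHn (m %/ pdiv m) _ k3.
  by apply: leq_trans (_ : m <= n) => //; rewrite ltn_Pdiv ?prime_gt1 // ltnW.
by exists q => //; apply: dvdn_trans q_dvd (dvdn_div p_dvd).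
Qed.

Lemma exists_prime3mod4_gt n : exists p, (n < p) && prime3mod4 p.
Proof.
have f_gt0 := fact_gt0 n.
have [|p p3 p_dvd] := @prime3mod4_dvd (4 * (n`!).-1 + 3).
  by rewrite mulnC modnMDl.
exists p; rewrite p3 andbT ltnNge; apply/negP => le_pn.
have p_pr : prime p by case/andP: p3.
have : p %| 4 * n`! by rewrite dvdn_mull // dvdn_fact // prime_gt0.
have -> : 4 * n`! = (4 * (n`!).-1 + 3) + 1.
  by rewrite -addnA -{1}(prednK f_gt0) mulnS addnC.
by rewrite dvdn_addr // dvdn1 => /eqP p1; rewrite p1 in p_pr.
Qed.

Definition next_prime3mod4 (n : nat) : nat := ex_minn (exists_prime3mod4_gt n).

(** [q_ i] is the [i]-th prime congruent to 3 modulo 4, counted from [q_ 1 = 3];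
    [q_ 0 = 0] is a dummy value that starts the recursion. *)
Definition q_ (i : nat) : nat := iter i next_prime3mod4 0.

Lemma q_S i : prime3mod4 (q_ i.+1) /\ q_ i < q_ i.+1 /\
  forall p, prime3mod4 p -> q_ i < p -> q_ i.+1 <= p.
Proof.
rewrite /q_ iterS /next_prime3mod4; case: ex_minnP => m /andP[ltm m3] minm.
by split=> //; split=> // p p3 ltp; apply: minm; rewrite ltp.
Qed.

Lemma q_rank i : count prime3mod4 (iota 0 (q_ i).+1) = i.
Proof.
elim: i => [//|i IHi]; have [q3 [ltq minq]] := q_S i.
have -> : (q_ i.+1).+1 = (q_ i).+1 + (q_ i.+1 - (q_ i).+1) + 1.
  by rewrite subnKC // addn1.
rewrite !iotaD !count_cat IHi add0n subnKC //= q3 !addn0.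
rewrite (_ : count _ _ = 0) ?addn0 ?addn1 //.
apply/eqP; rewrite -leqn0 leqNgt -has_count; apply/hasPn => p.
rewrite mem_iota subnKC // => /andP[lep ltp].
by apply/negP => p3; move: ltp; rewrite ltnNge minq.
Qed.

Definition is_prod_distinct_primes3mod4 (i nu : nat) : Prop :=
  exists s : seq nat,
    [/\ uniq s, size s = i, all prime3mod4 s & nu = \prod_(p <- s) p].

Definition S_ (i : nat) : set nat :=
  [set n | exists2 nu, is_prod_distinct_primes3mod4 i nu
                     & n = q_ i ^ 4 * nu ^ 2]%classic.

Definition setS : set nat := (\bigcup_(i in [set i | 1 <= i]) S_ i)%classic.

Definition counting_set (R : realType) (A : set nat) (x : R) : set nat :=
  [set n | A n /\ (n%:R < x)%R]%classic.

Lemma finite_counting_set (R : realType) (A : set nat) (x : R) :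
  finite_set (counting_set A x).
Proof.
apply: (@sub_finite_set _ _ `I_(Num.truncn x).+1); last exact: finite_II.
move=> n [_ ltnx] /=; rewrite -(ltr_nat R).
exact: lt_trans ltnx (truncnS_gt x).
Qed.

(** [fset_set] is the empty set on infinite sets; [finite_counting_set] rules
    this out here. *)
Definition counting_fun (R : realType) (A : set nat) (x : R) : nat :=
  #|` fset_set (counting_set A x)|.

Definition asymp_gg (R : realType) (f g : R -> R) : Prop :=
  (exists2 c : R, 0 < c & \forall x \near +oo, c * g x <= f x)%R.

(* Main.v *)
Require Import Defs.
From mathcomp Require Import all_boot all_order all_algebra.
From mathcomp Require Import all_classical all_reals all_analysis.
From mathcomp Require Import finfield.
From mathcomp Require Import ring lra zify.

Import Order.TTheory GRing.Theory Num.Theory.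

Set Implicit Arguments.
Unset Strict Implicit.
Unset Printing Implicit Defensive.

Local Open Scope ring_scope.

(** Property P comes from sums of two squares. Every element of [setS] is a square
    [A ^ 2] with [A = q_ i ^ 2 * nu], and all prime factors of [A] are congruent
    to 3 modulo 4. No such prime divides a sum of two squares unless it divides
    both of them, so [A ^ 2 %| B ^ 2 + C ^ 2] forces [A %| B]
    ([square_dvd_sum_squares]). Since [nu] is squarefree, the factor [q_ i ^ 2]
    allows [A %| B], for another square [B ^ 2] in [setS], only if [A = B]
    ([sqrt_setS_dvd]).

    For the lower bound, put [y = sqrt x / (2 * q_ K.+1 ^ 2)] with [K] of order
    [ln (ln x)]; then [q_ K.+1] is [O(ln (ln x) * ln (ln (ln x)))], and it is
    enough to produce many products [nu <= y] of at most [K.+1] distinct primes congruent to 3 modulo 4, namely a constant times [y / sqrt (ln y)]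
    of them. The arithmetic input is Mertens' theorem for these primes [p],
    [\sum_(p <= N) ln p / p = ln N / 2 + O(1)] ([mertens3_bounds]): the weight
    [1 - chi], with [chi] the nontrivial character modulo 4, isolates them, and
    [L(1, chi) != 0] is visible on the alternating series [1 - 1/3 + 1/5 - ...].
    Three consequences are used: there are at least a constant times [N / ln N]
    such primes between [N / C] and [N] ([count_prime3mod4_block]), the sum of
    [1 / p] is [ln (ln N) / 2 + O(1)] ([recip3_bounds]), and the product of
    [1 + 1 / p] is at least a constant times [sqrt (ln N)] ([prod_recip3_ge]).

    The numbers [nu] are taken of the form [m * p], where [m] is a squarefree
    product of primes up to [w], a small power of [x], and [p > w] is a single prime
    of size about [y / m]. For fixed [m] there are at least a constant times
    [y / (m * ln y)] choices of [p]. It remains to sum [1 / m] over the [m] that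
    have at most [K] prime factors and are at most [w ^ 4]. Without these two
    restrictions the sum is the product of [1 + 1 / p], of order
    [sqrt (ln w)]; the average number of prime factors and the average of [ln m]
    with respect to the weights [1 / m] are at most [\sum 1 / p] and
    [\sum ln p / p], so by Markov's inequality the restrictions cost at most half
    of it ([markov_subsets], [counting_setS_ge]). *)

(** * Property P *)

(** [-1] is not a square modulo [p]: if [c] were invertible, [t = b / c] would
    satisfy [t ^ 2 = -1], so [t ^ (p - 1) = (-1) ^ ((p - 1) / 2) = -1],
    against Fermat. *)
Lemma prime3mod4_dvd_sum_squares p b c :
  prime3mod4 p -> (p %| b ^ 2 + c ^ 2)%N -> (p %| b)%N /\ (p %| c)%N.
Proof.
case/andP=> p_pr /eqP p3 pbc.
have charFp := pchar_Fp p_pr.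
have F0 n : (p %| n)%N = (n%:R == 0 :> 'F_p) by rewrite (dvdn_pcharf charFp).
have bc0 : (b%:R : 'F_p) ^+ 2 + c%:R ^+ 2 = 0.
  by apply/eqP; rewrite -!natrX -natrD -F0.
have c0 : c%:R = 0 :> 'F_p.
  apply/eqP/negP => /negP cN0.
  set t : 'F_p := b%:R / c%:R.
  have t2 : t ^+ 2 = -1.
    apply: (mulIf (expf_neq0 2 cN0)); rewrite -exprMn /t mulfVK //.
    by apply/eqP; rewrite mulN1r -addr_eq0 bc0.
  have t0 : t != 0.
    by apply/eqP => t0; move/eqP: t2; rewrite t0 expr0n /= eq_sym oppr_eq0 oner_eq0.
  have tp : t ^+ p.-1 = 1.
    apply: (mulfI t0); rewrite -exprS prednK ?prime_gt0 // mulr1.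
    by have := expf_card t; rewrite card_Fp.
  have pE : p.-1 = (2 * (2 * (p %/ 4) + 1))%N.
    by move: (divn_eq p 4); rewrite p3; lia.
  move/eqP: tp; rewrite pE exprM t2 addn1 exprS exprM sqrrN expr1n expr1n mulr1.
  rewrite eq_sym -subr_eq0 opprK -(natrD _ 1 1) -F0 => p2.
  have p_le2 : (p <= 2)%N by exact: dvdn_leq p2.
  by move: p3; rewrite modn_small; lia.
split; rewrite F0; last exact/eqP.
by move/eqP: bc0; rewrite c0 expr0n /= addr0 expf_eq0 /= => ->.
Qed.

(** Descent: a prime factor [p] of [A] divides both [B] and [C] by the previous
    lemma, and [p ^ 2] cancels from the divisibility. *)
Lemma square_dvd_sum_squares A B C : (0 < A)%N ->
  (forall p, prime p -> (p %| A)%N -> p %% 4 = 3)%N ->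
  (A ^ 2 %| B ^ 2 + C ^ 2)%N -> (A %| B)%N.
Proof.
have [n] := ubnP A; elim: n A B C => // n IHn A B C ltAn A0 A3 dvdA.
have [A1|A1] := leqP A 1; first by have -> : A = 1%N by lia.
have p_pr := pdiv_prime A1; set p := pdiv A in p_pr.
have pA : (p %| A)%N := pdiv_dvd A.
have p3 : prime3mod4 p by rewrite /prime3mod4 p_pr A3.
have p0 := prime_gt0 p_pr.
have [|pB pC] := @prime3mod4_dvd_sum_squares p B C p3.
  by apply: dvdn_trans dvdA; apply: dvdn_trans pA _; rewrite expnS dvdn_mulr.
move: A0 A1 A3 dvdA ltAn; case/dvdnP: pA => a ->.
case/dvdnP: pB => b ->; case/dvdnP: pC => d -> A0 A1 A3 dvdA ltAn.
rewrite dvdn_pmul2r //; apply: (IHn a b d).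
- by apply: leq_trans (_ : a * p <= n)%N => //; rewrite ltn_Pmulr ?prime_gt1 //; lia.
- by lia.
- by move=> r r_pr ra; apply: A3 => //; rewrite dvdn_mulr.
- move: dvdA; rewrite !expnMn -mulnDl dvdn_pmul2r // expn_gt0 p0 //.
Qed.

Lemma q_prime3mod4 i : (0 < i)%N -> prime3mod4 (q_ i).
Proof. by case: i => // i _; case: (q_S i). Qed.

Lemma q_lt i j : (i < j)%N -> (q_ i < q_ j)%N.
Proof.
elim: j => // j IHj; rewrite ltnS leq_eqVlt => /predU1P[->|/IHj ltij].
  by case: (q_S j) => _ [].
by apply: ltn_trans ltij _; case: (q_S j) => _ [].
Qed.

Lemma prime_dvd_prod_primes p (s : seq nat) :
  prime p -> all prime s -> (p %| \prod_(r <- s) r)%N = (p \in s).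
Proof.
move=> p_pr; elim: s => [|r s IHs] /=; first by rewrite big_nil dvdn1; case: p p_pr => [|[]].
case/andP=> r_pr /IHs IH; rewrite big_cons Euclid_dvdM // IH in_cons.
by rewrite dvdn_prime2.
Qed.

Lemma prime3mod4_all_prime s : all prime3mod4 s -> all prime s.
Proof. by apply: sub_all => p /andP[]. Qed.

(** Divisibility between the square roots of elements of [setS] is equality:
    [q_ i ^ 2] divides [q_ j ^ 2 * nu'] with [nu'] squarefree only if
    [q_ i = q_ j], and then [nu] divides [nu'] while both have [i] prime
    factors. *)
Lemma sqrt_setS_dvd i j nu nu' : (0 < i)%N -> (0 < j)%N ->
  is_prod_distinct_primes3mod4 i nu -> is_prod_distinct_primes3mod4 j nu' ->
  (q_ i ^ 2 * nu %| q_ j ^ 2 * nu')%N -> i = j /\ nu = nu'.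
Proof.
move=> i0 j0 [s [us sz_s s3 ->]] [s' [us' sz_s' s3' ->]] dvd.
have /andP[qi_pr _] := q_prime3mod4 i0; have /andP[qj_pr _] := q_prime3mod4 j0.
have ps := prime3mod4_all_prime s3; have ps' := prime3mod4_all_prime s3'.
have ij : i = j.
  apply/eqP/negPn/negP => ij.
  have qN : coprime (q_ i ^ 2) (q_ j ^ 2).
    rewrite coprimeXl // coprimeXr // prime_coprime // dvdn_prime2 //.
    by move: ij; rewrite neq_ltn => /orP[] /q_lt; rewrite neq_ltn => ->; rewrite ?orbT.
  have q2 : (q_ i ^ 2 %| \prod_(r <- s') r)%N.
    by rewrite -(Gauss_dvdr _ qN); apply: dvdn_trans dvd; rewrite dvdn_mulr.
  have qs : q_ i \in s'.
    rewrite -prime_dvd_prod_primes //; apply: dvdn_trans q2.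
    by rewrite expnS dvdn_mulr.
  move: q2; rewrite (perm_big _ (perm_to_rem qs)) /= big_cons expnS expn1.
  rewrite dvdn_pmul2l ?prime_gt0 // prime_dvd_prod_primes //.
    by rewrite mem_rem_uniq // inE eqxx.
  by apply/allP => r /mem_rem /(allP ps').
split=> //; move: dvd; rewrite ij dvdn_pmul2l ?expn_gt0 ?prime_gt0 // => dvd.
have sub : {subset s <= s'}.
  move=> r rs; rewrite -prime_dvd_prod_primes //; last exact: (allP ps).
  by apply: dvdn_trans dvd; rewrite prime_dvd_prod_primes //; apply: (allP ps).
apply: perm_big; apply: uniq_perm => //.
by have [] := uniq_min_size us sub; rewrite ?sz_s ?sz_s' ?ij.
Qed.

Lemma expn4_2 u v : (u ^ 4 * v ^ 2 = (u ^ 2 * v) ^ 2)%N.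
Proof. by rewrite expnMn -expnM. Qed.

Lemma property_P_setS : property_P setS.
Proof.
have prod_gt0 i nu : is_prod_distinct_primes3mod4 i nu -> (0 < nu)%N.
  case=> s [_ _ /prime3mod4_all_prime ps ->].
  by rewrite big_seq_cond prodn_cond_gt0 // => r; rewrite andbT => /(allP ps) /prime_gt0.
have q0 i : (0 < i)%N -> (0 < q_ i)%N.
  by move=> /q_prime3mod4 /andP[/prime_gt0].
split=> [a [i /= i0 [nu nuP ->]]|].
  by rewrite muln_gt0 !expn_gt0 q0 //= (prod_gt0 _ _ nuP).
move=> a b c [i /= i0 [nu nuP ->]] [j /= j0 [nu' nuP' ->]] [k /= k0 [nu'' _ ->]].
rewrite !expn4_2 => ltab _; apply/negP => dvd.
have A0 : (0 < q_ i ^ 2 * nu)%N by rewrite muln_gt0 !expn_gt0 q0 //= (prod_gt0 _ _ nuP).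
have [] := @sqrt_setS_dvd i j nu nu' => //; last first.
  by move=> eij enu; move: ltab; rewrite eij enu ltnn.
apply: square_dvd_sum_squares dvd => // p p_pr; case: nuP => s [_ _ s3 ->].
rewrite Euclid_dvdM // => /orP[|].
  rewrite Euclid_dvdX // andbT => pq; have /andP[qp /eqP q3] := q_prime3mod4 i0.
  by move: pq; rewrite dvdn_prime2 // => /eqP->.
rewrite prime_dvd_prod_primes ?prime3mod4_all_prime // => /(allP s3).
by case/andP=> _ /eqP.
Qed.

(** * Logarithms and summation by parts *)

Lemma ln_sub_le (R : realType) (a b : R) : 0 < a -> 0 < b ->
  ln b - ln a <= (b - a) / a.
Proof.
move=> a0 b0; rewrite -ln_div ?posrE //.
have -> : b / a = 1 + (b - a) / a by field; rewrite gt_eqF.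
by apply: le_ln1Dx; rewrite ltr_pdivlMr // mulN1r ltrBrDl subrr.
Qed.

Lemma ln2_le1 (R : realType) : ln 2 <= 1 :> R.
Proof. by have := @ln_sub_le R 1 2 ltac:(lra) ltac:(lra); rewrite ln1; lra. Qed.

Lemma le_ln (R : realType) (a b : R) : 0 < a -> a <= b -> ln a <= ln b.
Proof. by move=> a0 ab; rewrite ler_ln ?posrE // (lt_le_trans a0). Qed.

Lemma ln_le_self (R : realType) (a : R) : 0 < a -> ln a <= a.
Proof. by move/ln_sublinear/ltW. Qed.

Lemma ln_nat_ge0 (R : realType) n : 0 <= ln n%:R :> R.
Proof. by case: n => [|n]; [rewrite ln0 | rewrite ln_ge0 // ler1n]. Qed.

Lemma ler_ln_nat (R : realType) m n : (0 < m)%N -> (m <= n)%N ->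
  ln m%:R <= ln n%:R :> R.
Proof.
by move=> m0 mn; rewrite ler_ln ?posrE ?ltr0n ?ler_nat // (leq_trans m0).
Qed.

Lemma ln_prod (R : realType) (I : Type) (r : seq I) (P : pred I) (F : I -> nat) :
  (forall i, P i -> (0 < F i)%N) ->
  ln (\prod_(i <- r | P i) F i)%:R = \sum_(i <- r | P i) ln (F i)%:R :> R.
Proof.
move=> F0; elim: r => [|i r IHr]; first by rewrite !big_nil ln1.
rewrite !big_cons; case: ifP => // Pi; rewrite natrM lnM ?posrE ?ltr0n ?F0 ?IHr //.
by rewrite prodn_cond_gt0.
Qed.

(** Summation by parts, with [C] the partial sums of [c]: the sum is
    [C b * f b + \sum_(a <= k < b) C k.+1 * (f k - f k.+1)], and the bounds
    [f k - f k.+1] of the last terms telescope. *)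
Lemma abel_bound (R : realType) (c f : nat -> R) a b :
  (forall n, (a <= n)%N -> `|\sum_(a <= k < n) c k| <= 1) ->
  (forall n, (a <= n)%N -> f n.+1 <= f n) ->
  (forall n, (a <= n)%N -> 0 <= f n) -> (a <= b)%N ->
  `|\sum_(a <= n < b) c n * f n| <= f a.
Proof.
move=> cb fd f0 ab; set C := fun n => \sum_(a <= k < n) c k.
have key n : (a <= n)%N -> \sum_(a <= k < n) c k * f k =
    C n * f n + \sum_(a <= k < n) C k.+1 * (f k - f k.+1).
  elim: n => [|n IHn].
    by rewrite leqn0 => /eqP ->; rewrite /C !big_geq // mul0r addr0.
  rewrite leq_eqVlt => /predU1P[<-|]; first by rewrite /C !big_geq // mul0r addr0.
  rewrite ltnS => an; rewrite !big_nat_recr //= IHn // /C !big_nat_recr //=.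
  by ring.
rewrite key //; apply: le_trans (ler_normD _ _) _.
have : `|\sum_(a <= k < b) C k.+1 * (f k - f k.+1)| <= \sum_(a <= k < b) - (f k.+1 - f k).
  apply: le_trans (ler_norm_sum _ _ _) _; rewrite !big_nat.
  apply: ler_sum => k /andP[ak _]; rewrite opprB normrM [`|f k - _|]ger0_norm ?subr_ge0 ?fd //.
  by rewrite ler_piMl ?subr_ge0 ?fd // cb // ltnW.
rewrite sumrN telescope_sumr // opprB.
have : `|C b * f b| <= f b.
  by rewrite normrM [`|f b|]ger0_norm ?f0 // ler_piMl ?f0 ?cb.
by lra.
Qed.

(** * The nontrivial character modulo 4 *)

Definition chi {R : realType} (n : nat) : R :=
  if (n %% 4)%N == 1 then 1 else if (n %% 4)%N == 3 then -1 else 0.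

Lemma chiM (R : realType) m n : chi (m * n) = chi m * chi n :> R.
Proof.
rewrite /chi -modnMm.
have := ltn_pmod m (isT : 0 < 4)%N; have := ltn_pmod n (isT : 0 < 4)%N.
by case: (m %% 4)%N (n %% 4)%N => [|[|[|[|?]]]] [|[|[|[|?]]]] //= _ _;
  rewrite ?mulr0 ?mul0r ?mulr1 ?mul1r ?mulrNN ?mulr1.
Qed.

Lemma chi_norm (R : realType) n : `|chi n : R| <= 1.
Proof. by rewrite /chi; case: ifP => _; [|case: ifP => _]; rewrite ?normrN ?normr1 ?normr0. Qed.

Lemma sum_chi (R : realType) a b : (a <= b)%N -> `|\sum_(a <= n < b) chi n : R| <= 1.
Proof.
have E n : \sum_(0 <= k < n) chi k = (((n %% 4)%N == 2) || ((n %% 4)%N == 3))%:R :> R.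
  elim: n => [|n IHn]; first by rewrite big_geq.
  rewrite big_nat_recr //= IHn /chi -[n.+1]addn1 -[((n + 1) %% 4)%N]modnDml.
  have := ltn_pmod n (isT : 0 < 4)%N.
  by case: (n %% 4)%N => [|[|[|[|?]]]] //= _; rewrite ?addr0 ?add0r ?subrr.
move=> ab; have : \sum_(0 <= n < b) chi n = \sum_(0 <= n < a) chi n + \sum_(a <= n < b) chi n :> R.
  by rewrite -big_cat_nat.
rewrite !E => /eqP; rewrite addrC -subr_eq => /eqP <-.
by case: (_ || _); case: (_ || _); rewrite ?subrr ?subr0 ?sub0r ?normrN ?normr1 ?normr0.
Qed.

Lemma sum_chi_div_tail (R : realType) M N : (M <= N)%N ->
  `|\sum_(1 <= m < N.+1) chi m / m%:R - \sum_(1 <= m < M.+1) chi m / m%:R : R|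
    <= M.+1%:R^-1.
Proof.
move=> MN; rewrite (@big_cat_nat _ _ _ M.+1 1 N.+1) //= addrAC subrr add0r.
apply: (@abel_bound R _ (fun m => m%:R^-1)) => // n Mn.
  exact: sum_chi.
by rewrite lef_pV2 ?posrE ?ltr0n ?ler_nat //; lia.
Qed.

(** The partial sums of [L(1, chi) = 1 - 1/3 + 1/5 - ...] stay away from [0]. *)
Lemma sum_chi_div_ge (R : realType) N : (0 < N)%N ->
  2 / 3 <= \sum_(1 <= m < N.+1) chi m / m%:R :> R.
Proof.
case: N => // -[_|N _]; first by rewrite big_nat1 /chi /= divr1; lra.
have := @sum_chi_div_tail R 2 N.+2 isT.
have -> : \sum_(1 <= m < 3) chi m / m%:R = 1 :> R.
  by rewrite big_nat_recr //= big_nat1 /chi /= divr1 mul0r addr0.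
by rewrite ler_norml => /andP[+ _]; lra.
Qed.

Lemma sum_chi_ln (R : realType) N :
  `|\sum_(1 <= n < N.+1) chi n / n%:R * ln n%:R : R| <= 2.
Proof.
(* [ln n / n] is decreasing as soon as [1 <= ln n]; [n <= 3] is treated apart. *)
have ln4 : 1 <= ln 4 :> R.
  have := @ln_sub_le R 2 1 ltac:(lra) ltac:(lra).
  have -> : 4 = 2 * 2 :> R by lra.
  by rewrite lnM ?posrE // ln1; lra.
have ln3 : ln 3 / 3 <= 1 :> R.
  have := @ln_sub_le R 1 3 ltac:(lra) ltac:(lra); rewrite ln1; lra.
have ln30 : 0 <= ln 3 :> R by exact: (ln_nat_ge0 R 3).
have ln44 : ln 4 / 4 <= 1 :> R.
  have := @ln_sub_le R 1 4 ltac:(lra) ltac:(lra); rewrite ln1; lra.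
have small : \sum_(1 <= n < 4) chi n / n%:R * ln n%:R = - (ln 3 / 3) :> R.
  do 2 rewrite big_nat_recr //=; rewrite big_nat1 /chi /= ln1 mulr0 add0r.
  by rewrite !mul0r add0r !mulN1r mulrC mulrN.
have [N3|N3] := leqP 3 N; last first.
  case: N N3 => [|[|[|]]] // _.
  - by rewrite big_geq // normr0.
  - by rewrite big_nat1 ln1 mulr0 normr0.
  - by rewrite big_nat_recr //= big_nat1 ln1 /chi /= mulr0 !mul0r addr0 normr0.
rewrite (@big_cat_nat _ _ _ 4) //= small.
under eq_bigr do rewrite -mulrA.
have := @abel_bound R chi (fun n => n%:R^-1 * ln n%:R) 4 N.+1.
have f0 n : 0 <= n%:R^-1 * ln n%:R :> R by rewrite mulr_ge0 ?ln_nat_ge0.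
have fd n : (4 <= n)%N -> n.+1%:R^-1 * ln n.+1%:R <= n%:R^-1 * ln n%:R :> R.
  move=> n4; have n0 : 0 < n%:R :> R by rewrite ltr0n; lia.
  have n1 : 0 < n.+1%:R :> R by rewrite ltr0n.
  have lnn : 1 <= ln n%:R :> R by apply: le_trans ln4 _; apply: (@ler_ln_nat R 4).
  have := ln_sub_le n0 n1.
  rewrite -natr1 in n1 *; rewrite addrAC subrr add0r ler_pdivlMr // => h.
  rewrite [_^-1 * _]mulrC [n%:R^-1 * _]mulrC ler_pdivrMr // mulrAC ler_pdivlMr //.
  by lra.
move=> /(_ (fun n h => sum_chi R h) fd (fun n _ => f0 n) N3).
rewrite ler_norml => /andP[h1 h2]; rewrite ler_norml; apply/andP; split; lra.
Qed.

(** * The von Mangoldt function and Chebyshev's bound *)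

(** The double sum has at most one nonzero term, the one with [d = p ^ k]; in
    this form sums over [d] are turned into sums over [p] and [k] by exchanging
    summations. *)
Definition mangoldt {R : realType} (d : nat) : R :=
  \sum_(1 <= p < d.+1 | prime p) \sum_(1 <= k < d.+1 | d == (p ^ k)%N) ln p%:R.

Lemma mangoldt_widen (R : realType) d N : (d <= N)%N ->
  mangoldt d = \sum_(1 <= p < N.+1 | prime p)
                 \sum_(1 <= k < N.+1 | d == (p ^ k)%N) ln p%:R :> R.
Proof.
move=> dN; rewrite /mangoldt (@big_cat_nat _ _ _ d.+1 1 N.+1) //=.
rewrite [X in _ = _ + X]big1_seq ?addr0; last first.
  move=> p /andP[p_pr]; rewrite mem_index_iota => /andP[dp _].
  rewrite big1_seq // => k /andP[/eqP dE]; rewrite mem_index_iota => /andP[k1 _].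
  have := leq_pexp2l (prime_gt0 p_pr) k1; rewrite -dE expn1; lia.
apply: eq_bigr => p p_pr; rewrite (@big_cat_nat _ _ _ d.+1 1 N.+1) //=.
rewrite [X in _ = _ + X]big1_seq ?addr0 //.
move=> k /andP[/eqP dE]; rewrite mem_index_iota => /andP[dk _].
by have := ltn_expl k (prime_gt1 p_pr); rewrite -dE; lia.
Qed.

Lemma mangoldt_ge0 (R : realType) d : 0 <= mangoldt d :> R.
Proof. by do 2 apply: sumr_ge0 => ? _; exact: ln_nat_ge0. Qed.

Lemma sum_mangoldt (R : realType) N (P : pred nat) (h : nat -> R) :
  \sum_(1 <= d < N.+1 | P d) mangoldt d * h d =
  \sum_(1 <= p < N.+1 | prime p)
    \sum_(1 <= k < N.+1 | (p ^ k <= N)%N && P (p ^ k)%N) ln p%:R * h (p ^ k)%N.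
Proof.
rewrite big_nat_cond.
under eq_bigr => d /andP[/andP[_ dN] _].
  rewrite (@mangoldt_widen R d N) // big_distrl /=.
  under eq_bigr do rewrite big_distrl /=.
  over.
rewrite -big_nat_cond exchange_big /=; apply: eq_bigr => p p_pr.
rewrite (exchange_big_dep predT) //= [RHS]big_mkcond /=; apply: eq_bigr => k _.
have pk0 : (0 < p ^ k)%N by rewrite expn_gt0 prime_gt0.
case: ifPn => [/andP[pkN Ppk]|H].
  rewrite big_mkcond (bigD1_seq (p ^ k)%N) ?mem_index_iota ?iota_uniq ?pk0 //=.
  rewrite Ppk eqxx big1 ?addr0 // => d dpk.
  by case: ifP => // /andP[_ /eqP dE]; rewrite dE eqxx in dpk.
rewrite big1_seq // => d /andP[/andP[Pd /eqP dE]]; rewrite mem_index_iota => /andP[_ dN].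
by move: H; rewrite -dE Pd andbT -ltnS dN.
Qed.

Lemma sum_mangoldt_dvd (R : realType) n N : (0 < n <= N)%N ->
  \sum_(1 <= d < N.+1 | (d %| n)%N) mangoldt d = ln n%:R :> R.
Proof.
case/andP=> n0 nN; under eq_bigr do rewrite -[mangoldt _]mulr1.
rewrite (sum_mangoldt N (fun d => d %| n)%N (fun=> 1)).
rewrite -[in RHS](partnT n0) (widen_partn _ nN) ln_prod; last first.
  by move=> p _; case: p => [|p]; rewrite ?logn0 // expn_gt0.
rewrite big_ltn //= lognE /= expn0 ln1 add0r [LHS]big_mkcond /=.
apply: eq_bigr => p _; case: ifP => p_pr; last by rewrite lognE p_pr /= ln1.
have ltl : (logn p n < N.+1)%N.
  by rewrite ltnS (leq_trans _ nN) // ltnW // ltn_logl.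
rewrite natrX lnXn ?ltr0n ?prime_gt0 //.
rewrite (@big_cat_nat _ _ _ (logn p n).+1) //= [X in _ + X]big1_seq ?addr0; last first.
  move=> k /andP[/andP[_]]; rewrite pfactor_dvdn // mem_index_iota => kl.
  by rewrite ltnNge kl.
rewrite big_mkcond big_nat (eq_bigr (fun=> ln p%:R)); last first.
  move=> k /andP[k0 kl]; have pkn : (p ^ k %| n)%N by rewrite pfactor_dvdn.
  by rewrite pkn andbT (leq_trans (dvdn_leq n0 pkn)) ?mulr1.
by rewrite -big_nat sumr_const_nat subn1.
Qed.

Lemma sum_dvd (R : realType) d N (g : nat -> R) : (0 < d)%N ->
  \sum_(1 <= n < N.+1 | (d %| n)%N) g n = \sum_(1 <= m < (N %/ d)%N.+1) g (d * m)%N.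
Proof.
move=> d0; elim: N => [|N IHN]; first by rewrite div0n !big_geq.
rewrite big_mkcond big_nat_recr //= -big_mkcond IHN divnS //.
case: ifPn => [dN|_]; last by rewrite add0n addr0.
rewrite add1n [RHS]big_nat_recr //=; congr (_ + g _).
by have := divnS N d0; rewrite dN add1n => <-; rewrite mulnC divnK.
Qed.

(** The identity [ln n = \sum_(d %| n) mangoldt d], summed against a weight with
    [n = d * m]. *)
Lemma sum_ln_mangoldt (R : realType) N (g : nat -> R) :
  \sum_(1 <= n < N.+1) g n * ln n%:R =
  \sum_(1 <= d < N.+1) mangoldt d * \sum_(1 <= m < (N %/ d)%N.+1) g (d * m)%N.
Proof.
under [RHS]eq_big_nat => d /andP[d0 _] do rewrite -sum_dvd // big_distrr /=.
rewrite (exchange_big_dep predT) //=; apply: eq_big_nat => n nN.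
by rewrite -(@sum_mangoldt_dvd R n N) // big_distrr /=; apply: eq_bigr => d _; rewrite mulrC.
Qed.

Lemma sum_ln_bounds (R : realType) N :
  N%:R * ln N%:R - N%:R <= \sum_(1 <= n < N.+1) ln (n%:R : R) <= N%:R * ln N%:R.
Proof.
elim: N => [|N /andP[lo up]]; first by rewrite big_geq // mul0r subrr lexx.
rewrite big_nat_recr //=; case: N lo up => [|N] lo up.
  by rewrite big_geq // ln1 mulr0 !add0r lexx andbT; lra.
have N0 : 0 < N.+1%:R :> R by rewrite ltr0n.
have N1 : 0 < N.+2%:R :> R by rewrite ltr0n.
have := ln_sub_le N0 N1; have : ln N.+1%:R <= ln N.+2%:R :> R by exact: ler_ln_nat.
rewrite -[N.+2%:R]natr1 addrAC subrr add0r ler_pdivlMr // natr1 => mono diff.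
have : N.+1%:R * ln N.+1%:R <= N.+1%:R * ln N.+2%:R :> R by rewrite ler_pM2l.
have -> : N.+2%:R * ln N.+2%:R = N.+1%:R * ln N.+2%:R + ln N.+2%:R :> R.
  by rewrite -[X in X * _]natr1 mulrDl mul1r.
have NE : N.+2%:R = N.+1%:R + 1 :> R by rewrite natr1.
by move: diff; rewrite mulrBl => diff mono2; apply/andP; split; lra.
Qed.

Lemma sum_ln_floor (R : realType) N :
  \sum_(1 <= n < N.+1) ln n%:R =
  \sum_(1 <= d < N.+1) mangoldt d * (N %/ d)%:R :> R.
Proof.
have := @sum_ln_mangoldt R N (fun=> 1).
under eq_bigr do rewrite mul1r.
by move=> ->; apply: eq_bigr => d _; rewrite sumr_const_nat subn1.
Qed.

(** Chebyshev: the numbers [2M %/ d - 2 * (M %/ d)] are nonnegative, and are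
    [1] for [M < d <= 2M]; so [\sum_(M < d <= 2M) mangoldt d] is at most
    [ln (2M)! - 2 ln M! <= 4 M]. *)
Lemma chebyshev_block (R : realType) M :
  \sum_(M.+1 <= d < (2 * M)%N.+1) mangoldt d <= 4 * M%:R :> R.
Proof.
case: M => [|M]; first by rewrite big_geq // mulr0.
set m := M.+1; have m0 : 0 < m%:R :> R by rewrite ltr0n.
have [_ up] := andP (sum_ln_bounds R (2 * m)); have [lo _] := andP (sum_ln_bounds R m).
have ln2 := ln2_le1 R.
have : \sum_(m.+1 <= d < (2 * m)%N.+1) mangoldt d + 2 * \sum_(1 <= n < m.+1) ln n%:R
    <= \sum_(1 <= n < (2 * m)%N.+1) ln n%:R :> R.
  rewrite !sum_ln_floor (@big_cat_nat _ _ _ m.+1 1 (2 * m).+1) //=; last by lia.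
  rewrite addrC big_distrr /=; apply: lerD; rewrite !big_nat.
    apply: ler_sum => d /andP[d0 dm]; rewrite ler_peMr ?mangoldt_ge0 //.
    by rewrite ler1n divn_gt0 //; lia.
  apply: ler_sum => d /andP[d0 dm]; rewrite mulrCA ler_wpM2l ?mangoldt_ge0 //.
  by rewrite -natrM ler_nat leq_divRL // -mulnA leq_mul2l leq_trunc_div orbT.
move: up; rewrite natrM lnM ?posrE // mulrDr.
have : 2 * m%:R * ln 2 <= 2 * m%:R :> R by rewrite ler_piMr // mulr_ge0 // ltW.
lra.
Qed.

Lemma chebyshev (R : realType) N :
  \sum_(1 <= d < N.+1) mangoldt d <= 6 * N%:R :> R.
Proof.
have [n] := ubnP N; elim: n N => // n IHn N ltNn.
have [N0|N0] := posnP N; first by rewrite N0 big_geq // mulr0.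
set M := (N %/ 2)%N; have NE : N = (2 * M + N %% 2)%N by rewrite mulnC -divn_eq.
have bnd := chebyshev_block R M.
have IH : \sum_(1 <= d < M.+1) mangoldt d <= 6 * M%:R :> R by apply: IHn; rewrite /M; lia.
have M2 : \sum_(1 <= d < (2 * M)%N.+1) mangoldt d <= 10 * M%:R :> R.
  by rewrite (@big_cat_nat _ _ _ M.+1) //=; [lra | lia].
move: (ltn_pmod N (isT : 0 < 2)%N) NE; case: (N %% 2)%N => [|[|]] // _ NE.
  by rewrite NE addn0 natrM; have : 0 <= M%:R :> R := ler0n _ _; lra.
have -> : N = (2 * M).+1 by lia.
rewrite big_nat_recr //= -[X in _ <= _ * X]natr1 natrM.
suff : mangoldt (2 * M).+1 <= 2 * M%:R + 1 :> R by have : 0 <= M%:R :> R := ler0n _ _; lra.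
apply: (@le_trans _ _ (ln (2 * M).+1%:R)).
  rewrite -(@sum_mangoldt_dvd R _ (2 * M).+1) ?leqnn // big_mkcond big_nat_recr //= dvdnn.
  by rewrite lerDr sumr_ge0 // => i _; case: ifP => // _; exact: mangoldt_ge0.
have := @ln_sub_le R 1 (2 * M).+1%:R ltac:(lra) ltac:(by rewrite ltr0n).
by rewrite ln1 -natr1 natrM; lra.
Qed.

(** * Mertens' theorem for the primes congruent to 3 modulo 4 *)

(** [N * \sum_d mangoldt d / d] differs from
    [ln N! = \sum_d mangoldt d * (N %/ d)] by at most [\sum_d mangoldt d]. *)
Lemma mertens (R : realType) N : (0 < N)%N ->
  ln N%:R - 1 <= \sum_(1 <= d < N.+1) mangoldt d / (d%:R : R) <= ln N%:R + 6.
Proof.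
move=> N0; have Nr : 0 < N%:R :> R by rewrite ltr0n.
have [lo up] := andP (sum_ln_bounds R N).
have psi := chebyshev R N.
have h1 : \sum_(1 <= n < N.+1) ln n%:R <= N%:R * \sum_(1 <= d < N.+1) mangoldt d / d%:R :> R.
  rewrite sum_ln_floor big_distrr /= !big_nat; apply: ler_sum => d /andP[d0 _].
  rewrite mulrCA ler_wpM2l ?mangoldt_ge0 // ler_pdivlMr ?ltr0n // -natrM ler_nat.
  exact: leq_trunc_div.
have h2 : N%:R * \sum_(1 <= d < N.+1) mangoldt d / d%:R <=
    \sum_(1 <= n < N.+1) ln n%:R + \sum_(1 <= d < N.+1) mangoldt d :> R.
  rewrite sum_ln_floor big_distrr -big_split /= !big_nat; apply: ler_sum => d /andP[d0 _].
  rewrite -[X in _ <= _ + X]mulr1 -mulrDr mulrCA ler_wpM2l ?mangoldt_ge0 //.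
  by rewrite ler_pdivrMr ?ltr0n // natr1 -natrM ler_nat ltnW // ltn_ceil.
have k1 := le_trans lo h1; have k2 := le_trans h2 (lerD up psi).
move: k1 k2; have -> : N%:R * ln N%:R - N%:R = N%:R * (ln N%:R - 1) :> R by ring.
have -> : N%:R * ln N%:R + 6 * N%:R = N%:R * (ln N%:R + 6) :> R by ring.
by rewrite !ler_pM2l // => -> ->.
Qed.

(** In [\sum_n chi n * ln n / n], which is bounded, the convolution identity
    makes the partial sums of [L(1, chi)] appear; replacing them all by the
    longest one costs [\sum_d mangoldt d / N], and it is at least [2 / 3]. *)
Lemma mertens_chi (R : realType) N : (0 < N)%N ->
  `|\sum_(1 <= d < N.+1) mangoldt d * chi d / d%:R : R| <= 12.
Proof.
move=> N0; have Nr : 0 < N%:R :> R by rewrite ltr0n.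
set D := \sum_(_ <= _ < _) _.
set X : nat -> R := fun M => \sum_(1 <= m < M.+1) chi m / m%:R.
have E : \sum_(1 <= n < N.+1) chi n / n%:R * ln n%:R =
    \sum_(1 <= d < N.+1) mangoldt d * chi d / d%:R * X (N %/ d)%N :> R.
  rewrite sum_ln_mangoldt; apply: eq_bigr => d _.
  rewrite -!mulrA; congr (_ * _); rewrite mulrA /X big_distrr /=.
  by apply: eq_bigr => m _; rewrite chiM natrM invfM mulrACA.
have diff : `|D * X N - \sum_(1 <= n < N.+1) chi n / n%:R * ln n%:R| <= 6.
  rewrite E /D mulr_suml -sumrB; apply: le_trans (ler_norm_sum _ _ _) _.
  have : (\sum_(1 <= d < N.+1) mangoldt d) / N%:R <= 6 :> R.
    by rewrite ler_pdivrMr // chebyshev.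
  apply: le_trans; rewrite mulr_suml !big_nat; apply: ler_sum => d /andP[d0 dN].
  rewrite -mulrBr -!mulrA normrM ger0_norm ?mangoldt_ge0 // ler_wpM2l ?mangoldt_ge0 //.
  have dr : 0 < d%:R :> R by rewrite ltr0n.
  rewrite normrM -[leRHS]mul1r; apply: ler_pM => //; first exact: chi_norm.
  rewrite normrM gtr0_norm ?invr_gt0 // ler_pdivrMl //.
  apply: le_trans (sum_chi_div_tail R (leq_div N d)) _.
  by rewrite ler_pdivlMr // ler_pdivrMl ?ltr0n // -natrM ler_nat ltnW // ltn_ceil.
have Xge := sum_chi_div_ge R N0; rewrite -/(X N) in Xge.
have lnb := sum_chi_ln R N.
have : `|D * X N| <= 8.
  rewrite -[D * X N](subrK (\sum_(1 <= n < N.+1) chi n / n%:R * ln n%:R)).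
  by apply: le_trans (ler_normD _ _) _; lra.
rewrite normrM [`|X N|]ger0_norm; last by lra.
have : `|D| * (2 / 3) <= `|D| * X N by rewrite ler_wpM2l.
lra.
Qed.

Lemma sum_inv_expn_le (R : realType) (x : R) n : 1 < x ->
  \sum_(2 <= k < n.+2) (x ^+ k)^-1 <= (x * (x - 1))^-1.
Proof.
move=> x1; have x0 : 0 < x by lra.
have x10 : 0 < x - 1 by lra.
suff : \sum_(2 <= k < n.+2) (x ^+ k)^-1 + (x ^+ n.+1 * (x - 1))^-1 = (x * (x - 1))^-1.
  have : 0 <= (x ^+ n.+1 * (x - 1))^-1 by rewrite invr_ge0 mulr_ge0 ?exprn_ge0 // ltW.
  by lra.
elim: n => [|n IHn]; first by rewrite big_geq // add0r expr1.
rewrite big_nat_recr //= -IHn -addrA; congr (_ + _).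
rewrite !exprS; field.
by rewrite !gt_eqF // exprn_gt0.
Qed.

(** The [n]-th term is at most the decrease of [(ln n + 2) / n] from [n - 1] to
    [n]. *)
Lemma sum_ln_div_pronic (R : realType) N : (0 < N)%N ->
  \sum_(1 <= n < N.+1) ln n%:R / (n%:R * (n%:R - 1)) <= 2 - (ln N%:R + 2) / N%:R :> R.
Proof.
case: N => // N _; elim: N => [|N IHN]; first by rewrite big_nat1 ln1 mul0r; lra.
rewrite big_nat_recr //=; apply: le_trans (lerD IHN (lexx _)) _.
have N0 : 0 < N.+1%:R :> R by rewrite ltr0n.
have N1 : 1 <= N.+1%:R :> R by rewrite ler1n.
have := ln_sub_le N0 (ltr0Sn R N.+1).
rewrite -[N.+2%:R]natr1; set x := N.+1%:R in N0 N1 *.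
set u := ln x; set v := ln _; rewrite !addrK addrAC subrr add0r => h.
have x1 : 0 < x + 1 by lra.
have h2 : (x + 1) * (v - u) <= 2.
  apply: (@le_trans _ _ ((x + 1) * (1 / x))); first by rewrite ler_wpM2l // ltW.
  by rewrite mulrA mulr1 ler_pdivrMr //; lra.
rewrite -subr_ge0.
have -> : 2 - (v + 2) / (x + 1) - (2 - (u + 2) / x + v / ((x + 1) * x)) =
    (2 - (x + 1) * (v - u)) / (x * (x + 1)).
  by field; rewrite !gt_eqF.
by rewrite divr_ge0 ?mulr_ge0 // ?subr_ge0 // ltW.
Qed.

Definition mertens3 {R : realType} (N : nat) : R :=
  \sum_(1 <= p < N.+1 | prime3mod4 p) ln p%:R / p%:R.

(** [1 - chi] is [2] on the primes congruent to 3 and [0] on those congruent to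
    1; the prime [2] and the proper prime powers contribute only [O(ln p / p ^ 2)]. *)
Lemma mertens3_local (R : realType) N p : prime p -> (p <= N)%N ->
  2 * (if prime3mod4 p then ln p%:R / p%:R else 0) <=
    \sum_(1 <= k < N.+1 | (p ^ k <= N)%N)
      ln p%:R * ((1 - chi (p ^ k)%N) / (p ^ k)%:R : R) <=
  2 * (if prime3mod4 p then ln p%:R / p%:R else 0)
    + 4 * (ln p%:R / (p%:R * (p%:R - 1))).
Proof.
move=> p_pr pN; have p1 := prime_gt1 p_pr; have N0 : (0 < N)%N by lia.
have pr1 : 1 < p%:R :> R by rewrite ltr1n.
have pr0 : 0 < p%:R :> R by lra.
have lp := ln_nat_ge0 R p.
rewrite big_ltn_cond // expn1 pN.
have chi01 n : 0 <= 1 - (chi n : R) <= 2.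
  by rewrite /chi; case: ifP => _; [|case: ifP => _]; apply/andP; split; lra.
set T := \sum_(_ <= _ < _ | _) _.
have T0 : 0 <= T.
  apply: sumr_ge0 => k _; rewrite mulr_ge0 // divr_ge0 //.
  by case/andP: (chi01 (p ^ k)%N).
have T1 : T <= 2 * (ln p%:R / (p%:R * (p%:R - 1))).
  apply: (@le_trans _ _ (\sum_(2 <= k < N.-1.+2) 2 * (ln p%:R * (p%:R ^+ k)^-1))).
    rewrite /T big_mkcond prednK //; apply: ler_sum => k _.
    case: ifP => _; last by rewrite !mulr_ge0 // invr_ge0 exprn_ge0 // ltW.
    rewrite [leRHS]mulrCA ler_wpM2l // natrX ler_wpM2r ?invr_ge0 ?exprn_ge0 ?(ltW pr0) //.
    by case/andP: (chi01 (p ^ k)%N).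
  rewrite -!big_distrr /= ler_pM2l // ler_wpM2l //; exact: sum_inv_expn_le.
set E := ln p%:R / (p%:R * (p%:R - 1)) in T1 *.
have E0 : 0 <= E by rewrite divr_ge0 // mulr_ge0 // ltW //; lra.
rewrite /prime3mod4 p_pr /chi /=.
have [p3|p3] := eqVneq (p %% 4)%N 3%N.
  by rewrite p3 /= opprK; apply/andP; split; lra.
have [p1'|p1'] := eqVneq (p %% 4)%N 1%N.
  by rewrite subrr mul0r mulr0; apply/andP; split; lra.
have p2 : p = 2%N.
  have [//|po] := even_prime p_pr; move: (divn_eq p 4) (ltn_pmod p (isT : 0 < 4)%N) p1' p3.
  by lia.
move: T0 T1 E0 lp; rewrite /E p2 subr0.
have -> : 2 * (2 - 1) = 2 :> R by lra.
move=> T0 T1 E0 lp.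
by apply/andP; split; lra.
Qed.

(** By [mertens3_local], the sums in [mertens] and [mertens_chi] differ by
    [2 * mertens3 N] up to a convergent sum. *)
Lemma mertens3_bounds (R : realType) N : (0 < N)%N ->
  `|mertens3 N - ln N%:R / 2 : R| <= 11.
Proof.
move=> N0; have /andP[S1 S2] := @mertens R N N0.
have := @mertens_chi R N N0; rewrite ler_norml => /andP[D1 D2].
set S := \sum_(_ <= _ < _) _ in S1 S2; set D := \sum_(_ <= _ < _) _ in D1 D2.
have SDE : S - D = \sum_(1 <= p < N.+1 | prime p)
    \sum_(1 <= k < N.+1 | (p ^ k <= N)%N)
      ln p%:R * ((1 - chi (p ^ k)%N) / (p ^ k)%:R).
  rewrite -sumrB; have := sum_mangoldt N predT (fun d => (1 - chi d) / d%:R : R).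
  under eq_bigr do rewrite mulrA mulrBr mulr1 mulrBl.
  move=> ->; apply: eq_bigr => p _; apply: eq_bigl => k; exact: andbT.
have A2 : 2 * mertens3 N = \sum_(1 <= p < N.+1 | prime p)
    2 * (if prime3mod4 p then ln p%:R / p%:R else 0) :> R.
  rewrite -big_distrr /=; congr (_ * _); rewrite -big_mkcondr /=.
  by apply: eq_bigl => p; rewrite /prime3mod4 andbA andbb.
have P := sum_ln_div_pronic R N0.
have P2 : \sum_(1 <= p < N.+1 | prime p) (4 * (ln p%:R / (p%:R * (p%:R - 1)))) <= 8 :> R.
  rewrite -big_distrr /=.
  have : \sum_(1 <= p < N.+1 | prime p) ln p%:R / (p%:R * (p%:R - 1)) <=
      \sum_(1 <= n < N.+1) ln n%:R / (n%:R * (n%:R - 1)) :> R.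
    rewrite big_mkcond !big_nat; apply: ler_sum => n /andP[n0 _]; case: ifP => // _.
    by rewrite divr_ge0 ?ln_nat_ge0 // mulr_ge0 // subr_ge0 ler1n.
  have : 0 <= (ln N%:R + 2) / N%:R :> R by rewrite divr_ge0 // addr_ge0 ?ln_nat_ge0.
  lra.
have L1 : 2 * mertens3 N <= S - D.
  rewrite A2 SDE big_nat_cond [leRHS]big_nat_cond; apply: ler_sum => p /andP[/andP[_ pN] p_pr].
  by case/andP: (mertens3_local R p_pr pN).
have L2 : S - D <= 2 * mertens3 N + 8.
  apply: le_trans (lerD (lexx _) P2); rewrite A2 SDE -big_split /=.
  rewrite big_nat_cond [leRHS]big_nat_cond.
  apply: ler_sum => p /andP[/andP[_ pN] p_pr].
  by case/andP: (mertens3_local R p_pr pN).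
by rewrite ler_norml; apply/andP; split; lra.
Qed.

(** [mertens3] grows by at least [1] between [N / C] and [N], while each of the
    primes in between contributes at most [C * ln N / N]. *)
Lemma count_prime3mod4_block (R : realType) :
  exists2 C : nat, (1 < C)%N & forall N, (C <= N)%N ->
    N%:R <= C%:R * ln N%:R *
            (count prime3mod4 (index_iota (N %/ C).+1 N.+1))%:R :> R.
Proof.
(* [46 / 2] exceeds by [1] the error [2 * 11] of two uses of [mertens3_bounds]. *)
set C := (Num.truncn (expR 46 : R)).+1.
have lC : 46 <= ln C%:R :> R.
  rewrite -[leLHS]expRK ler_ln ?posrE ?expR_gt0 ?ltr0n //.
  exact: ltW (truncnS_gt _).
have C1 : (1 < C)%N.
  rewrite ltnNge; apply/negP => C1; have : ln C%:R <= 0 :> R by rewrite ln_le0 // lern1.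
  by lra.
exists C => // N CN; set M := (N %/ C)%N.
have M0 : (0 < M)%N by rewrite divn_gt0 // ltnW.
have N0 : (0 < N)%N by apply: leq_trans CN; apply: ltnW.
have Mr : 0 < M%:R :> R by rewrite ltr0n.
have Nr : 0 < N%:R :> R by rewrite ltr0n.
have Cr : 0 < C%:R :> R by rewrite ltr0n.
have MN : (M <= N)%N by apply: leq_div.
have := mertens3_bounds R N0; rewrite ler_norml => /andP[+ _].
have := mertens3_bounds R M0; rewrite ler_norml => /andP[_ +].
rewrite /mertens3 [X in _ <= X - _ -> _](@big_cat_nat _ _ _ M.+1 1 N.+1) //=.
have lNM : ln C%:R + ln M%:R <= ln N%:R :> R.
  by rewrite -lnM ?posrE // -natrM; apply: ler_ln_nat; rewrite ?muln_gt0 ?M0 // mulnC leq_trunc_div.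
set T := \sum_(M.+1 <= p < N.+1 | prime3mod4 p) ln p%:R / p%:R => hM hN.
have T1 : 1 <= T by lra.
have : T <= (count prime3mod4 (index_iota M.+1 N.+1))%:R * (C%:R * ln N%:R / N%:R).
  rewrite -sum1_count natr_sum big_distrl /= /T big_mkcond [leRHS]big_mkcond /= !big_nat.
  apply: ler_sum => p /andP[Mp pN]; case: ifP => // _; rewrite mul1r.
  have p0 : (0 < p)%N by apply: leq_trans Mp.
  rewrite ler_pdivrMr ?ltr0n // mulrAC ler_pdivlMr // mulrAC [leLHS]mulrC.
  apply: ler_pM; rewrite ?ler0n ?ln_nat_ge0 // ?ler_ln_nat //.
  by rewrite -natrM ler_nat mulnC ltnW // -ltn_divLR // ltnW.
move=> /(le_trans T1); rewrite !mulrA ler_pdivlMr // mul1r => /le_trans; apply.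
by rewrite -mulrA mulrC.
Qed.

Definition recip3 {R : realType} (N : nat) : R :=
  \sum_(1 <= p < N.+1 | prime3mod4 p) p%:R^-1.

(** Summation by parts against [1 / ln], in the form of an induction on [N]:
    the difference [d] increases by [mertens3 N * (1 / ln N - 1 / ln (N + 1))],
    that is, up to a telescoping error, by half the increment of [ln ln]. *)
Lemma recip3_parts (R : realType) N : (2 <= N)%N ->
  let d := recip3 N - mertens3 N / ln N%:R : R in
  let e := 11 * ((ln 2)^-1 - (ln N%:R)^-1) in
  (ln (ln N.+1%:R) - ln (ln 3)) / 2 - e <= d /\
  d <= (ln (ln N%:R) - ln (ln 2)) / 2 + e.
Proof.
have small (f : nat -> R) : \sum_(1 <= p < 3 | prime3mod4 p) f p = 0.
  by rewrite big_mkcond big_nat_recr //= big_nat1 addr0.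
case: N => [|[|N]] // _; elim: N => [|N [IHl IHu]].
  by rewrite /recip3 /mertens3 !small !subrr !mul0r mulr0 !subrr; split; lra.
move: IHl IHu; set n := N.+2 => IHl IHu /=.
have n0 : 0 < n%:R :> R by rewrite ltr0n.
have u0 : 0 < ln n%:R :> R by rewrite ln_gt0 // ltr1n.
have v0 : 0 < ln n.+1%:R :> R by rewrite ln_gt0 // ltr1n.
have w0 : 0 < ln n.+2%:R :> R by rewrite ln_gt0 // ltr1n.
have uv : ln n%:R <= ln n.+1%:R :> R by exact: ler_ln_nat.
have dE : recip3 n.+1 - mertens3 n.+1 / ln n.+1%:R =
    (recip3 n - mertens3 n / ln n%:R) + mertens3 n * ((ln n%:R)^-1 - (ln n.+1%:R)^-1) :> R.
  rewrite /recip3 /mertens3 big_mkcond big_nat_recr // -big_mkcond /=.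
  rewrite [X in _ - X / _]big_mkcond big_nat_recr // -big_mkcond /=.
  by case: ifP => _; field; rewrite !gt_eqF // ltr0n.
have := @mertens3_bounds R n isT; rewrite ler_norml => /andP[Al Au].
have lv := ln_sub_le u0 v0; have lw := ln_sub_le v0 w0.
have conc : ln n.+2%:R - ln n.+1%:R <= ln n.+1%:R - ln n%:R :> R.
  rewrite lerBlDr addrAC lerBrDr -!lnM ?posrE ?ltr0n // ler_ln ?posrE ?mulr_gt0 ?ltr0n //.
  rewrite -!natrM ler_nat.
  by rewrite mulSn mulnS leq_add2r.
rewrite dE; move: IHl IHu Al Au lv lw conc.
set u := ln n%:R in u0 uv *; set v := ln n.+1%:R in v0 uv *; set w := ln n.+2%:R in w0 *.
set A := mertens3 n; set D := recip3 n - _ => IHl IHu Al Au lv lw conc.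
have i0 : 0 <= u^-1 - v^-1 by rewrite subr_ge0 lef_pV2 ?posrE.
have b1 : (u / 2 - 11) * (u^-1 - v^-1) <= A * (u^-1 - v^-1) by rewrite ler_wpM2r //; lra.
have b2 : A * (u^-1 - v^-1) <= (u / 2 + 11) * (u^-1 - v^-1) by rewrite ler_wpM2r //; lra.
have ue : u * (u^-1 - v^-1) = (v - u) / v by field; rewrite !gt_eqF.
have b3 : ln w - ln v <= (v - u) / v by apply: le_trans lw _; rewrite ler_pM2r ?invr_gt0.
have b4 : (v - u) / v <= ln v - ln u.
  by have := ln_sub_le v0 u0; rewrite -lerN2 -mulNr !opprB.
by split; lra.
Qed.

(** Mertens' second theorem for the primes congruent to 3 modulo 4. *)
Lemma recip3_bounds (R : realType) :
  exists E : R, forall N, (2 <= N)%N -> `|recip3 N - ln (ln N%:R) / 2| <= E.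
Proof.
exists (12 + 11 / ln 2 + `|ln (ln 2)| + `|ln (ln 3)|) => N N2.
have [lo up] := recip3_parts R N2.
have N0 : (0 < N)%N by apply: leq_trans N2.
have := mertens3_bounds R N0; rewrite ler_norml => /andP[Al Au].
have u0 : 0 < ln N%:R :> R by rewrite ln_gt0 // ltr1n.
have mono : ln (ln N%:R) <= ln (ln N.+1%:R) :> R.
  by rewrite ler_ln ?posrE ?ln_gt0 ?ltr1n //; exact: ler_ln_nat.
have iu : 0 < (ln N%:R)^-1 :> R by rewrite invr_gt0.
have b1 : 1 / 2 - 11 * (ln N%:R)^-1 <= mertens3 N / ln N%:R :> R.
  by rewrite ler_pdivlMr // mulrBl mulfVK ?gt_eqF //; lra.
have b2 : mertens3 N / ln N%:R <= 1 / 2 + 11 * (ln N%:R)^-1 :> R.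
  by rewrite ler_pdivrMr // mulrDl mulfVK ?gt_eqF //; lra.
have := ler_norm (ln (ln 3) : R); have := ler_norm (- ln (ln 2) : R).
have := ler_norm (ln (ln 2) : R); have := ler_norm (- ln (ln 3) : R).
rewrite !normrN ler_norml => *.
have n2 := normr_ge0 (ln (ln 2) : R); have n3 := normr_ge0 (ln (ln 3) : R).
by apply/andP; split; lra.
Qed.

(** [1 + 1 / p >= exp (1 / (p + 1))], and replacing [1 / (p + 1)] by [1 / p] in the
    exponent costs a telescoping sum. *)
Lemma prod_recip3_ge (R : realType) :
  exists2 c : R, 0 < c & forall N, (2 <= N)%N ->
    c * Num.sqrt (ln N%:R) <= \prod_(1 <= p < N.+1 | prime3mod4 p) (1 + p%:R^-1).
Proof.
have [E HE] := recip3_bounds R; exists (expR (- E - 1)); first exact: expR_gt0.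
move=> N N2; have u0 : 0 < ln N%:R :> R by rewrite ln_gt0 // ltr1n.
have -> : Num.sqrt (ln N%:R) = expR (ln (ln N%:R) / 2) :> R.
  apply: (@pexpIrn _ 2) => //; rewrite ?nnegrE ?sqrtr_ge0 ?expR_ge0 //.
  by rewrite sqr_sqrtr ?ltW // -expRM_natr mulfVK // lnK // posrE.
rewrite -expRD.
have tel : \sum_(1 <= p < N.+1 | prime3mod4 p) (p%:R^-1 - p.+1%:R^-1) <= 1 :> R.
  apply: (@le_trans _ _ (\sum_(1 <= p < N.+1) - (p.+1%:R^-1 - p%:R^-1))).
    rewrite big_mkcond !big_nat; apply: ler_sum => p /andP[p0 _]; rewrite opprB.
    by case: ifP => // _; rewrite subr_ge0 lef_pV2 ?posrE ?ltr0n ?ler_nat.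
  rewrite sumrN telescope_sumr // opprB invr1.
  by rewrite gerBl invr_ge0.
apply: (@le_trans _ _ (expR (\sum_(1 <= p < N.+1 | prime3mod4 p) p.+1%:R^-1))).
  rewrite ler_expR; move: tel (HE N N2); rewrite sumrB -/(recip3 N) ler_norml.
  by move=> tel /andP[lo _]; lra.
rewrite expR_sum; apply: ler_prod => p /andP[p_pr _]; rewrite expR_ge0 /=.
have p0 : 0 < p%:R :> R by rewrite ltr0n prime_gt0.
have /= := expR_ge1Dx (- p.+1%:R^-1 : R); rewrite expRN.
rewrite -[X in X <= _]invrK lef_pV2 ?posrE ?invr_gt0 ?expR_gt0 //.
  move/le_trans; apply; rewrite -natr1 le_eqVlt; apply/orP; left; apply/eqP.
  by field; rewrite !gt_eqF //; lra.
by rewrite subr_gt0 invf_lt1 ?ltr0n // ltr1n ltnS prime_gt0.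
Qed.

(** * Weighted subsets *)

Lemma sum_subsets_prod (R : comNzRingType) (I : finType) (F : I -> R) :
  \sum_(J : {set I}) \prod_(i in J) F i = \prod_i (1 + F i).
Proof.
under [RHS]eq_bigr do rewrite addrC.
rewrite (bigA_distr _ _ F (fun=> 1)); apply: eq_bigr => J _.
by rewrite big_mkcond.
Qed.

Lemma sum_subsets_with (R : realDomainType) (I : finType) (F : I -> R) i :
  (forall i, 0 <= F i) ->
  \sum_(J : {set I} | i \in J) \prod_(j in J) F j
    <= F i * \sum_(J : {set I}) \prod_(j in J) F j.
Proof.
move=> F0; rewrite (reindex_onto (fun J => i |: J) (fun J => J :\ i)) /=; last first.
  by move=> J iJ; rewrite finset.setD1K.
rewrite big_distrr /= big_mkcond; apply: ler_sum => J _.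
case: ifP => [/andP[_ /eqP JE]|_]; last by rewrite mulr_ge0 ?prodr_ge0.
by rewrite big_setU1 //= -JE !inE eqxx.
Qed.

(** Markov's inequality for the additive statistic [\sum_(i in J) g i] of a random
    set [J] of weight [\prod_(i in J) F i]. *)
Lemma markov_subsets (R : realFieldType) (I : finType) (F g : I -> R) :
  (forall i, 0 <= F i) -> (forall i, 0 <= g i) -> \sum_i g i * F i <= 1 / 2 ->
  (\prod_i (1 + F i)) / 2 <=
  \sum_(J : {set I} | \sum_(i in J) g i <= 1) \prod_(i in J) F i.
Proof.
move=> F0 g0 gF; rewrite -sum_subsets_prod.
set W := \sum_(J : {set I}) _.
have W0 : 0 <= W by apply: sumr_ge0 => J _; rewrite prodr_ge0.
have mean : \sum_(J : {set I}) (\prod_(i in J) F i) * (\sum_(i in J) g i) <= 1 / 2 * W.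
  under eq_bigr do rewrite big_distrr /=.
  rewrite (exchange_big_dep predT) //=.
  apply: (@le_trans _ _ (\sum_i g i * F i * W)); last by rewrite -big_distrl /= ler_wpM2r.
  apply: ler_sum => i _; rewrite -big_distrl /= [leLHS]mulrC -mulrA.
  by rewrite ler_wpM2l // sum_subsets_with.
have split : W <= \sum_(J : {set I} | \sum_(i in J) g i <= 1) \prod_(i in J) F i
    + \sum_(J : {set I}) (\prod_(i in J) F i) * (\sum_(i in J) g i).
  rewrite /W [X in _ <= X + _]big_mkcond -big_split /=; apply: ler_sum => J _.
  have p0 : 0 <= \prod_(i in J) F i by rewrite prodr_ge0.
  case: ifPn => [_|]; first by rewrite lerDl mulr_ge0 // sumr_ge0.
  by rewrite -ltNge add0r => /ltW; exact: ler_peMr.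
lra.
Qed.

(** * Counting elements of [setS] *)

Lemma le_counting_fun (R : realType) (A : set nat) (x : R) (s : seq nat) :
  uniq s -> (forall n, n \in s -> A n /\ n%:R < x) ->
  (size s <= counting_fun A x)%N.
Proof.
move=> us sA; apply: uniq_leq_size => // n /sA nA.
by rewrite in_fset_set ?mem_set //; exact: finite_counting_set.
Qed.

Definition prod_ords w (J : {set 'I_w.+1}) : nat := \prod_(i in J) (i : nat).

Definition prime_factors w (J : {set 'I_w.+1}) (p : nat) : seq nat :=
  p :: [seq val i | i <- enum J].

Lemma prime_factorsP w (J : {set 'I_w.+1}) p :
  (forall i, i \in J -> prime3mod4 i) -> prime3mod4 p -> (w < p)%N ->
  [/\ uniq (prime_factors J p), size (prime_factors J p) = #|J|.+1,
      all prime3mod4 (prime_factors J p) &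
      (prod_ords J * p)%N = (\prod_(r <- prime_factors J p) r)%N].
Proof.
move=> J3 p3 wp; split=> /=.
- rewrite map_inj_uniq ?enum_uniq ?andbT; last exact: val_inj.
  apply/mapP => -[i _ /= pE]; have := ltn_ord i; rewrite -pE; lia.
- by rewrite size_map -cardE.
- by rewrite p3; apply/allP => _ /mapP[i + ->]; rewrite mem_enum => /J3.
- by rewrite big_cons big_map big_enum mulnC.
Qed.

(** [p] is recovered as the only prime factor exceeding [w], and [J] as the set of
    the others. *)
Lemma prod_ords_inj w (J J' : {set 'I_w.+1}) p p' :
  (forall i, i \in J -> prime3mod4 i) -> (forall i, i \in J' -> prime3mod4 i) ->
  prime3mod4 p -> prime3mod4 p' -> (w < p)%N -> (w < p')%N ->
  (prod_ords J * p = prod_ords J' * p')%N -> J = J' /\ p = p'.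
Proof.
move=> J3 J3' p3 p3' wp wp' E.
have [u _ a mE] := prime_factorsP J3 p3 wp.
have [u' _ a' mE'] := prime_factorsP J3' p3' wp'.
have mem r : prime r -> (r \in prime_factors J p) = (r \in prime_factors J' p').
  move=> r_pr; rewrite -!prime_dvd_prod_primes ?prime3mod4_all_prime //.
  by rewrite -mE -mE' E.
have notin (B : {set 'I_w.+1}) r : (w < r)%N -> (r \in [seq val i | i <- enum B]) = false.
  by move=> wr; apply/mapP => -[i _ /= rE]; have := ltn_ord i; rewrite -rE; lia.
have inB (B : {set 'I_w.+1}) r (i : 'I_w.+1) : (w < r)%N ->
    (val i \in prime_factors B r) = (i \in B).
  move=> wr; rewrite inE mem_map ?mem_enum; last exact: val_inj.
  by have := ltn_ord i; case: eqP => [/= ->|//]; lia.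
split; last first.
  have := mem p (proj1 (andP p3)); rewrite !inE eqxx /= notin // orbF.
  by move=> /esym /eqP.
apply/setP => i; case: (boolP (prime i)) => [i_pr|iN].
  by rewrite -(inB J p) // -(inB J' p') // mem.
have nJ (B : {set 'I_w.+1}) : (forall i, i \in B -> prime3mod4 i) -> i \in B = false.
  by move=> B3; apply/negP => /B3 /andP[i_pr _]; rewrite i_pr in iN.
by rewrite !nJ.
Qed.

Definition q_nu_square w (u : {set 'I_w.+1} * nat) : nat :=
  (q_ #|u.1|.+1 ^ 4 * (prod_ords u.1 * u.2) ^ 2)%N.

Lemma q_nu_square_inj w (A : {pred {set 'I_w.+1} * nat}) :
  (forall u, u \in A ->
     [/\ forall i, i \in u.1 -> prime3mod4 i, prime3mod4 u.2 & (w < u.2)%N]) ->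
  {in A &, injective (@q_nu_square w)}.
Proof.
move=> HA [J p] [J' p'] /HA[/= J3 p3 wp] /HA[/= J3' p3' wp'] E.
have nuP : is_prod_distinct_primes3mod4 #|J|.+1 (prod_ords J * p).
  by exists (prime_factors J p); have [] := prime_factorsP J3 p3 wp.
have nuP' : is_prod_distinct_primes3mod4 #|J'|.+1 (prod_ords J' * p').
  by exists (prime_factors J' p'); have [] := prime_factorsP J3' p3' wp'.
have [] := sqrt_setS_dvd (ltn0Sn _) (ltn0Sn _) nuP nuP'.
  rewrite -(@dvdn_pexp2r _ _ 2) //.
  by move: E; rewrite /q_nu_square /= !expn4_2 => ->.
by move=> _ /(prod_ords_inj J3 J3' p3 p3' wp wp')[-> ->].
Qed.

(** Each [n = q_ k ^ 4 * nu ^ 2] with [nu = prod_ords J * p <= y] and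
    [k = #|J| + 1 <= K + 1] is below [x], as [q_ k <= q_ K.+1]. The sets [J] are those of small size and product, on
    which [markov_subsets] locates half of the total weight; for each of them
    the primes [p] fill a final segment of [[1, y / prod_ords J]]. *)
Lemma counting_setS_ge (R : realType) (C w K y : nat) (x : R) :
  (forall N, (C <= N)%N -> N%:R <= C%:R * ln N%:R *
     (count prime3mod4 (index_iota (N %/ C).+1 N.+1))%:R :> R) ->
  (1 < C)%N -> (C <= w)%N -> (w ^ 6 <= y)%N -> (0 < K)%N ->
  mertens3 w / (4 * ln (w%:R : R)) + recip3 w / K%:R <= 1 / 2 ->
  (q_ K.+1 ^ 4 * y ^ 2)%:R < x ->
  y%:R * \prod_(1 <= p < w.+1 | prime3mod4 p) (1 + p%:R^-1)
    <= 4 * C%:R * ln y%:R * (counting_fun setS x)%:R :> R.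
Proof.
move=> HC C1 Cw wy K0 stat qyx.
have w1 : (1 < w)%N by apply: leq_trans Cw.
have w0 : (0 < w)%N by apply: ltnW.
have y0 : (0 < y)%N by apply: leq_trans wy; rewrite expn_gt0 w0.
have lw : 0 < ln w%:R :> R by rewrite ln_gt0 // ltr1n.
have Kr : 0 < K%:R :> R by rewrite ltr0n.
(* [\sum_(i in J) g i <= 1] entails both [ln (prod_ords J) <= ln (w ^ 4)] and
   [#|J| <= K]. *)
pose F (i : 'I_w.+1) : R := if prime3mod4 i then i%:R^-1 else 0.
pose g (i : 'I_w.+1) : R := ln i%:R / (4 * ln w%:R) + K%:R^-1.
have F0 i : 0 <= F i by rewrite /F; case: ifP.
have lg0 (i : 'I_w.+1) : 0 <= ln i%:R / (4 * ln w%:R) :> R.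
  by rewrite divr_ge0 ?ln_nat_ge0 // mulr_ge0 // ltW.
have g0 i : 0 <= g i by rewrite addr_ge0 // invr_ge0 ltW.
have ord_sum (f : nat -> R) :
    \sum_(i < w.+1) (if prime3mod4 i then f i else 0) = \sum_(1 <= p < w.+1 | prime3mod4 p) f p.
  by rewrite -(big_mkord predT (fun i => if prime3mod4 i then f i else 0)) big_ltn //= add0r -big_mkcond.
have prodE : \prod_i (1 + F i) = \prod_(1 <= p < w.+1 | prime3mod4 p) (1 + p%:R^-1).
  rewrite [RHS]big_mkcond /=.
  rewrite -(big_mkord predT (fun i => 1 + (if prime3mod4 i then i%:R^-1 else 0 : R))).
  rewrite [LHS]big_ltn //= addr0 mul1r; apply: eq_bigr => p _.
  by case: ifP => //; rewrite addr0.
have gF : \sum_i g i * F i <= 1 / 2.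
  apply: le_trans stat; rewrite /mertens3 /recip3 !big_distrl -big_split /= -ord_sum.
  apply: ler_sum => i _; rewrite /g /F; case: ifP => _; last by rewrite mulr0.
  by rewrite mulrDl mulrAC [_^-1 * _]mulrC.
have := markov_subsets F0 g0 gF; rewrite prodE => half.
pose good (J : {set 'I_w.+1}) :=
  [forall i in J, prime3mod4 i] && (\sum_(i in J) g i <= 1).
have {}half : (\prod_(1 <= p < w.+1 | prime3mod4 p) (1 + p%:R^-1)) / 2
    <= \sum_(J | good J) (prod_ords J)%:R^-1 :> R.
  apply: le_trans half _; rewrite big_mkcond [leRHS]big_mkcond; apply: ler_sum => J _.
  rewrite /good andbC; case: ifP => //= _; case: ifPn => [/forall_inP J3|].
    rewrite /prod_ords natr_prod -prodfV; apply: ler_prod => i iJ.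
    by rewrite F0 /F J3 //= lexx.
  by move=> /forall_inPn [i iJ iN]; rewrite (bigD1 i) //= /F (negbTE iN) mul0r.
have goodP J : good J -> [/\ forall i, i \in J -> prime3mod4 i,
    (#|J| <= K)%N, (0 < prod_ords J)%N & (prod_ords J <= w ^ 4)%N].
  case/andP=> /forall_inP J3 gJ.
  have i0 i : i \in J -> (0 < i)%N by move=> /J3 /andP[/prime_gt0].
  have m0 : (0 < prod_ords J)%N by apply: prodn_cond_gt0.
  split=> //.
    rewrite -(ler_nat R) -[leRHS]mul1r -ler_pdivrMr //; apply: le_trans gJ.
    rewrite -sum1_card natr_sum big_distrl /=; apply: ler_sum => i _.
    by rewrite mul1r /g lerDr.
  rewrite -(ler_nat R) -ler_ln ?posrE ?ltr0n ?expn_gt0 ?w0 //.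
  rewrite natrX lnXn ?ltr0n // -[ln w%:R *+ 4]mulr_natl -[leRHS]mul1r -ler_pdivrMr ?mulr_gt0 //.
  apply: le_trans gJ; rewrite /prod_ords ln_prod // big_distrl /=.
  by apply: ler_sum => i _; rewrite /g lerDl invr_ge0 ltW.
pose Y J := (y %/ @prod_ords w J)%N.
have YP J : good J -> [/\ (C <= Y J)%N, (w <= Y J %/ C)%N &
    y%:R / (2 * (prod_ords J)%:R) <= (Y J)%:R :> R].
  case/goodP=> _ _ m0 mw.
  have w2Y : (w ^ 2 <= Y J)%N.
    rewrite leq_divRL //; apply: leq_trans wy.
    by rewrite (expnD w 2 4) leq_mul2l mw orbT.
  have CY : (w <= Y J %/ C)%N.
    by rewrite leq_divRL ?(ltnW C1) //; apply: leq_trans w2Y; rewrite expnS expn1 leq_mul2l Cw orbT.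
  have wY : (w <= Y J)%N by apply: leq_trans w2Y; rewrite expnS expn1 leq_pmulr.
  split=> //; first exact: leq_trans wY.
  rewrite ler_pdivrMr ?mulr_gt0 ?ltr0n // -!natrM ler_nat.
  have : (y <= (Y J).+1 * prod_ords J)%N by rewrite ltnW // ltn_ceil.
  move/leq_trans; apply; rewrite mulnA leq_mul2r; apply/orP; right.
  by rewrite muln2 -addnn -addn1 leq_add2l (leq_trans w0).
pose block J := [seq p <- index_iota (Y J %/ C).+1 (Y J).+1 | prime3mod4 p].
pose s := [seq (J, p) | J <- enum good, p <- block J].
have sP u : u \in s -> [/\ good u.1, prime3mod4 u.2, (w < u.2)%N & (prod_ords u.1 * u.2 <= y)%N].
  case/allpairsPdep=> J [p []]; rewrite mem_enum => gJ + -> /=.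
  have [_ wY _] := YP _ gJ; have [_ _ m0 _] := goodP _ gJ.
  rewrite mem_filter mem_index_iota ltnS => /and3P[p3 Yp pY].
  split=> //; first exact: leq_ltn_trans Yp.
  by apply: leq_trans (leq_trunc_div y (prod_ords J)); rewrite mulnC leq_mul2r pY orbT.
have us : uniq [seq q_nu_square u | u <- s].
  rewrite map_inj_in_uniq.
    apply: allpairs_uniq_dep; rewrite ?enum_uniq //.
      by move=> J _; rewrite filter_uniq // iota_uniq.
    by move=> [J p] [J' p'] _ _ [-> ->].
  by apply: q_nu_square_inj => u /sP[/goodP[]].
have /(le_counting_fun us) : forall n, n \in [seq q_nu_square u | u <- s] ->
    setS n /\ n%:R < x.
  move=> _ /mapP[[J p] /sP[/= gJ p3 wp my] ->].
  have [J3 JK _ _] := goodP _ gJ; split.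
    exists #|J|.+1 => //=; exists (prod_ords J * p)%N => //.
    by exists (prime_factors J p); have [] := prime_factorsP J3 p3 wp.
  apply: le_lt_trans qyx; rewrite ler_nat /q_nu_square /=.
  apply: leq_mul; rewrite leq_exp2r //.
  by move: JK; rewrite leq_eqVlt => /predU1P[->//|/(q_lt (i:=#|J|.+1) (j:=K.+1))/ltnW].
rewrite size_map size_allpairs_dep -(ler_nat R) => cnt.
have ly : 0 < ln y%:R :> R.
  rewrite ln_gt0 // ltr1n; apply: leq_trans wy; apply: leq_trans w1 _.
  by rewrite expnS leq_pmulr ?expn_gt0 ?w0.
apply: le_trans (ler_wpM2l _ cnt); last by rewrite !mulr_ge0 // ltW.
rewrite sumnE big_map big_enum natr_sum big_distrr /=.
apply: (@le_trans _ _ (2 * y%:R * \sum_(J | good J) (prod_ords J)%:R^-1)).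
  by have yr : 0 <= y%:R :> R by []; rewrite [2 * _]mulrC -mulrA ler_wpM2l // mulrC -ler_pdivrMr.
rewrite big_distrr /=; apply: ler_sum => J gJ.
have [CY _ Yge] := YP _ gJ; have [_ _ m0 _] := goodP _ gJ.
rewrite size_filter.
have Y0 : (0 < Y J)%N by apply: leq_trans CY; apply: ltnW.
have lY : ln (Y J)%:R <= ln y%:R :> R by apply: ler_ln_nat => //; exact: leq_div.
have HY := HC _ CY; move: Yge; rewrite ler_pdivrMr ?mulr_gt0 ?ltr0n // => Yge.
rewrite ler_pdivrMr ?ltr0n //.
set c := (count _ _)%:R in HY *.
have c0 : 0 <= c by exact: ler0n.
have HY2 : (Y J)%:R <= C%:R * ln y%:R * c.
  by apply: le_trans HY _; rewrite ler_wpM2r // ler_wpM2l.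
have : (Y J)%:R * (2 * (prod_ords J)%:R) <= C%:R * ln y%:R * c * (2 * (prod_ords J)%:R).
  by rewrite ler_wpM2r // mulr_ge0.
by lra.
Qed.

(** * Size of the parameters *)

(** [q_rank] turns the lower bound for the number of primes into an upper bound
    for the [k]-th of them. *)
Lemma q_le (R : realType) (C k Z : nat) :
  (forall N, (C <= N)%N -> N%:R <= C%:R * ln N%:R *
     (count prime3mod4 (index_iota (N %/ C).+1 N.+1))%:R :> R) ->
  (1 < C)%N -> (C <= Z)%N -> C%:R * ln Z%:R * k%:R <= Z%:R :> R -> (q_ k <= Z)%N.
Proof.
move=> HC C1 CZ kZ; case: k kZ => // k kZ.
rewrite leqNgt; apply/negP => Zq.
have Z1 : (1 < Z)%N by apply: leq_trans CZ.
have pos : 0 < C%:R * ln Z%:R :> R.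
  by rewrite mulr_gt0 ?ltr0n ?ln_gt0 ?ltr1n // ltnW.
have := le_trans kZ (HC Z CZ); rewrite ler_pM2l // ler_nat => kcount.
have := q_rank k.+1.
have -> : iota 0 (q_ k.+1).+1 = iota 0 Z.+1 ++ iota Z.+1 (q_ k.+1 - Z).
  by rewrite -iotaD; congr iota; lia.
rewrite count_cat => E.
have : (0 < count prime3mod4 (iota Z.+1 (q_ k.+1 - Z)))%N.
  rewrite -has_count; apply/hasP; exists (q_ k.+1); last exact: q_prime3mod4.
  by rewrite mem_iota; lia.
have : (count prime3mod4 (index_iota (Z %/ C).+1 Z.+1) <= count prime3mod4 (iota 0 Z.+1))%N.
  have := leq_div Z C => ZC.
  have -> : iota 0 Z.+1 = iota 0 (Z %/ C).+1 ++ index_iota (Z %/ C).+1 Z.+1.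
    by rewrite -iotaD subnKC.
  by rewrite [leqRHS]count_cat leq_addl.
by lia.
Qed.

(** A lower bound on the triple logarithm entails all the largeness conditions on
    [x] used below. *)
Lemma near_lnlnln (R : realType) (T : R) :
  \forall x \near +oo, [/\ expR (expR (expR T)) <= x & T <= ln (ln (ln x))].
Proof.
near=> x.
have h : expR (expR (expR T)) <= x by near: x; apply: nbhs_pinfty_ge; rewrite num_real.
split=> //; rewrite -[leLHS]expRK; apply: le_ln; rewrite ?expR_gt0 //.
rewrite -[leLHS]expRK; apply: le_ln; rewrite ?expR_gt0 //.
by rewrite -[leLHS]expRK; apply: le_ln; rewrite ?expR_gt0.
Unshelve. all: by end_near.
Qed.

(** Below a number [Z] between [18 * C * L * ln L] and twice as much there are at
    least [Z / (C * ln Z)] primes congruent to 3 modulo 4; as [ln Z <= 3 * ln L],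
    these are at least [6 * L]. *)
Lemma q_upper (R : realType) (C K : nat) (L : R) :
  (forall N, (C <= N)%N -> N%:R <= C%:R * ln N%:R *
     (count prime3mod4 (index_iota (N %/ C).+1 N.+1))%:R :> R) ->
  (1 < C)%N -> 1 <= ln L -> ln (36 * C%:R) <= ln L -> K.+1%:R <= 6 * L ->
  (q_ K.+1)%:R <= 36 * C%:R * (L * ln L).
Proof.
move=> HC C1 L1 LC KL; have L0 : 0 < L.
  by rewrite ltNge; apply/negP => /ln0; move: L1 => /[swap] ->; lra.
have C0 : 1 <= C%:R :> R by rewrite ler1n ltnW.
have Lge : 1 <= L by apply: le_trans L1 (ln_le_self L0).
have LL : 1 <= L * ln L by rewrite -[leLHS]mul1r ler_pM.
have CLL : 1 <= C%:R * (L * ln L) by rewrite -[leLHS]mul1r ler_pM.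
set t : R := 18 * C%:R * (L * ln L).
have tE : t = 18 * (C%:R * (L * ln L)) by rewrite /t -mulrA.
have t1 : 1 <= t by rewrite tE; lra.
pose Z := (Num.truncn t).+1.
have tZ : t <= Z%:R by apply: ltW; exact: truncnS_gt.
have Zt : Z%:R <= 36 * C%:R * (L * ln L).
  have -> : 36 * C%:R * (L * ln L) = 2 * t by rewrite /t; ring.
  have : (Num.truncn t)%:R <= t by rewrite truncn_le; lra.
  by rewrite /Z -natr1; lra.
apply: (le_trans _ Zt); rewrite ler_nat; apply: (q_le HC) => //.
  rewrite -(ler_nat R); apply: (le_trans _ tZ); rewrite tE.
  have Cge : C%:R <= C%:R * (L * ln L) by apply: ler_peMr; rewrite // ler0n.
  lra.
apply: (le_trans _ tZ).
have lnZ : ln Z%:R <= 3 * ln L.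
  apply: (@le_trans _ _ (ln (36 * C%:R * (L * ln L)))).
    by apply: le_ln Zt; rewrite ltr0n.
  have lL : 0 < ln L by lra.
  have C36 : 0 < 36 * C%:R :> R by lra.
  have -> : ln (36 * C%:R * (L * ln L)) = ln (36 * C%:R) + (ln L + ln (ln L)) :> R.
    by rewrite -[ln L + _]lnM ?posrE // -lnM ?posrE // mulr_gt0.
  by have := ln_le_self lL; lra.
have : C%:R * ln Z%:R * K.+1%:R <= C%:R * (3 * ln L) * (6 * L).
  apply: ler_pM => //; first by rewrite mulr_ge0 ?ln_nat_ge0.
  by rewrite ler_wpM2l.
by move/le_trans; apply; rewrite /t le_eqVlt; apply/orP; left; apply/eqP; ring.
Qed.

Lemma sqrt_expR (R : realType) (a : R) : Num.sqrt (expR a) = expR (a / 2).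
Proof.
apply: (@pexpIrn _ 2) => //; rewrite ?nnegrE ?sqrtr_ge0 ?expR_ge0 //.
by rewrite sqr_sqrtr ?expR_ge0 // -expRM_natr mulfVK.
Qed.

(** From the Taylor term [t ^ 5 / 5!] of [exp t]: [1920 = 2 * 8 * 5!]. *)
Lemma expR_exp_ge_pow4 (R : realType) (m t : R) : 0 <= m -> 1920 * m <= t -> 0 < t ->
  2 * (m * t ^+ 4) <= expR (expR t / 8).
Proof.
move=> m0 mt t0.
have e5 : 1 + t ^+ 5 / 120 <= expR t := expR_ge1Dxn 4 (ltW t0).
have e1 := expR_ge1Dx (expR t / 8).
have : 1920 * m * t ^+ 4 <= t * t ^+ 4 by rewrite ler_wpM2r // exprn_ge0 // ltW.
rewrite -exprS -mulrA => h; lra.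
Qed.

Lemma truncn_expR_bounds (R : realType) (a : R) : 1 <= a ->
  [/\ (Num.truncn (expR a))%:R <= expR a,
      a - 1 <= ln (Num.truncn (expR a))%:R,
      ln (Num.truncn (expR a))%:R <= a &
      forall m, m%:R <= a -> (m <= Num.truncn (expR a))%N].
Proof.
move=> a1; set w := Num.truncn _.
have we : w%:R <= expR a by rewrite truncn_le expR_ge0.
have ew : expR a < w.+1%:R by exact: truncnS_gt.
have lew m : m%:R <= a -> (m <= w)%N.
  rewrite truncn_ge_nat ?expR_ge0 // => /le_trans; apply.
  by apply: le_trans (expR_ge1Dx _); rewrite lerDr.
have w0 : 0 < w%:R :> R by rewrite ltr0n; exact: (lew 1%N).
split=> //; last by rewrite -[leRHS]expRK; exact: le_ln.
have : a <= ln (2 * w%:R).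
  rewrite -[leLHS]expRK; apply: le_ln; first exact: expR_gt0.
  apply: le_trans (ltW ew) _; rewrite -natr1 mulr_natl mulr2n lerD2l ler1n.
  by rewrite -(ltr0n R).
by rewrite lnM ?posrE //; have := ln2_le1 R; lra.
Qed.

Lemma stat_le_half (R : realType) (w K : nat) (E L : R) : (2 <= w)%N ->
  `|recip3 w - ln (ln w%:R) / 2| <= E -> 22 <= ln (w%:R : R) ->
  ln (ln w%:R) <= L -> 4 * L <= K%:R -> 2 * E <= L -> 0 < L ->
  mertens3 w / (4 * ln (w%:R : R)) + recip3 w / K%:R <= 1 / 2.
Proof.
move=> w2 HE lw lnlnw K4 EL L0.
have := mertens3_bounds R (ltnW w2); rewrite ler_norml => /andP[_ A].
have := HE; rewrite ler_norml => /andP[_ B].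
have a : mertens3 w / (4 * ln w%:R) <= 1 / 4 :> R.
  by rewrite ler_pdivrMr; lra.
have b : recip3 w / K%:R <= 1 / 4 :> R.
  by rewrite ler_pdivrMr; lra.
by lra.
Qed.

(** The final computation: the count [S] is at least [y * W / ln y] up to a
    constant, with [W] of order [r = sqrt (ln x)], [ln y] of order at most
    [r ^ 2] and [y] of order [sx / q ^ 2], where [sx = sqrt x]. *)
Lemma combine_bounds (R : realType) (c C M q y W ly r sx D S : R) :
  0 < c -> 0 < C -> 0 < M -> 0 <= y -> 0 < r -> 0 < D -> 0 <= S ->
  y * W <= 4 * C * ly * S -> c * (r / 6) <= W -> ly <= r * r ->
  sx <= 4 * q * y -> q <= M * D ->
  c / (96 * C * M) * (sx / (r * D)) <= S.
Proof.
move=> c0 C0 M0 y0 r0 D0 S0 HS HW Hly Hsx Hq.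
have step : y * c <= 24 * C * r * S.
  have : y * (c * (r / 6)) <= 4 * C * (r * r) * S.
    apply: le_trans (ler_wpM2l y0 HW) _; apply: le_trans HS _.
    by rewrite ler_wpM2r // ler_wpM2l // mulr_ge0 // ltW.
  rewrite (_ : y * _ = y * c / 6 * r); last by ring.
  rewrite (_ : 4 * C * _ * S = 4 * C * r * S * r); last by ring.
  by rewrite ler_pM2r //; lra.
have sxD : sx <= 4 * (M * D) * y.
  by apply: le_trans Hsx _; rewrite ler_wpM2r // ler_pM2l.
rewrite mulf_div ler_pdivrMr ?mulr_gt0 // [leLHS]mulrC.
apply: le_trans (ler_wpM2r (ltW c0) sxD) _.
rewrite -[leLHS]mulrA; apply: le_trans (ler_wpM2l _ step) _.
  by rewrite mulr_ge0 // ltW // mulr_gt0.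
by rewrite le_eqVlt; apply/orP; left; apply/eqP; ring.
Qed.

Lemma setS_lower_bound (R : realType) : exists2 c : R, 0 < c &
  exists T : R, forall x : R, expR (expR (expR T)) <= x -> T <= ln (ln (ln x)) ->
    c * (Num.sqrt x / (Num.sqrt (ln x) * ln (ln x) ^+ 2 * ln (ln (ln x)) ^+ 2))
      <= (counting_fun setS x)%:R.
Proof.
have [C C1 HC] := count_prime3mod4_block R.
have [c0 c00 Hc0] := prod_recip3_ge R.
have [E HE] := recip3_bounds R.
have C0 : 0 < C%:R :> R by rewrite ltr0n ltnW.
pose M : R := 36 * C%:R.
have M0 : 0 < M by rewrite mulr_gt0.
exists (c0 / (96 * C%:R * M ^+ 2)); first by rewrite divr_gt0 // !mulr_gt0 // exprn_gt0.
(* The summands serve, in this order, to make [w] and [K] large, to absorb the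
   error term of [recip3_bounds], to have [2 * q ^ 2 <= exp (l / 8)], and to
   dominate [C] and [ln M]. *)
pose T : R := 1000 + 2 * `|E| + 1920 * M ^+ 2 + M.
have [Tk TE TM TC] : [/\ 1000 <= T, 2 * E <= T, 1920 * M ^+ 2 <= T & M <= T].
  have := normr_ge0 E; have := ler_norm E; have := exprn_ge0 2 (ltW M0).
  by rewrite /T => *; split; lra.
exists T => x; move: T Tk TE TM TC => T Tk TE TM TC.
set l := ln x; set L1 := ln l; set L2 := ln L1 => xT TL2.
have x0 : 0 < x by apply: lt_le_trans xT; exact: expR_gt0.
have lT : expR (expR T) <= l by rewrite -[leLHS]expRK le_ln ?expR_gt0.
have l0 : 0 < l by apply: lt_le_trans lT; exact: expR_gt0.
have L1T : expR T <= L1 by rewrite -[leLHS]expRK le_ln ?expR_gt0.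
have L10 : 0 < L1 by apply: lt_le_trans L1T; exact: expR_gt0.
have L20 : 0 < L2 by apply: (@lt_le_trans _ _ 1000) (le_trans Tk TL2); rewrite ltr0n.
have L21 : L2 <= L1 := ln_le_self L10.
have L1l : L1 <= l := ln_le_self l0.
have TL1 := le_trans TL2 L21.
have Tl := le_trans TL1 L1l.
have kl := le_trans Tk Tl.
have xE : x = expR l by rewrite lnK.
have lE : l = expR L1 by rewrite lnK.
clear xT lT L1T.
(* The prime factors other than the largest one are at most w. *)
pose w := Num.truncn (expR (l / 16)).
have [|we lnw_ge lnw_le lew] := @truncn_expR_bounds R (l / 16); first by clear -kl; lra.
rewrite -/w in we lnw_ge lnw_le lew.
have Cw : (C <= w)%N.
  by apply: lew; have := le_trans TC Tl; rewrite /M; clear -C0; lra.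
have w2 : (2 <= w)%N by apply: leq_trans Cw.
have lnw22 : 22 <= ln w%:R :> R by clear -lnw_ge kl; lra.
(* There are at most K of them. *)
pose K := (Num.truncn (4 * L1)).+1.
have K4 : 4 * L1 <= K%:R by apply: ltW; exact: truncnS_gt.
have K5 : K.+1%:R <= 6 * L1.
  have : (Num.truncn (4 * L1))%:R <= 4 * L1 by rewrite truncn_le mulr_ge0 // ltW.
  by have := le_trans Tk TL1; rewrite -[K.+1%:R]natr1 -[K%:R]natr1; clear; lra.
have stat : mertens3 w / (4 * ln (w%:R : R)) + recip3 w / K%:R <= 1 / 2.
  apply: (stat_le_half (E := E) (L := L1)) => //; first exact: HE.
    by apply: le_ln; [clear -lnw22; lra | clear -lnw_le l0; lra].
  exact: le_trans TE TL1.
pose q := q_ K.+1.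
have q0 : (0 < q)%N by case/andP: (q_prime3mod4 (ltn0Sn K)) => /prime_gt0.
have qr : 0 < q%:R :> R by rewrite ltr0n.
have qM : q%:R <= M * (L1 * L2).
  apply: (q_upper HC) => //; first by apply: le_trans (le_trans Tk TL2); rewrite ler1n.
  exact: le_trans (ln_le_self M0) (le_trans TC TL2).
have q2M : q%:R ^+ 2 <= M ^+ 2 * (L1 ^+ 2 * L2 ^+ 2) :> R.
  by rewrite -!exprMn ler_pXn2r ?nnegrE // ltW // !mulr_gt0.
have q2e : 2 * q%:R ^+ 2 <= expR (l / 8).
  apply: (@le_trans _ _ (2 * (M ^+ 2 * L1 ^+ 4))); last first.
    rewrite lE; apply: expR_exp_ge_pow4 => //; first by rewrite exprn_ge0 // ltW.
    exact: le_trans TM TL1.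
  rewrite ler_pM2l //; apply: le_trans q2M _; rewrite ler_pM2l ?exprn_gt0 //.
  by rewrite (exprD _ 2 2) ler_pM2l ?exprn_gt0 // ler_pXn2r ?nnegrE // ltW.
(* All the products nu in use are at most y. *)
pose s : R := Num.sqrt x / (2 * q%:R ^+ 2).
have q20 : 0 < 2 * q%:R ^+ 2 :> R by rewrite mulr_gt0 // exprn_gt0.
have sx : Num.sqrt x = expR (l / 2) by rewrite xE sqrt_expR.
have s0 : 0 < s by rewrite divr_gt0 // sx expR_gt0.
pose y := Num.truncn s.
have ys : y%:R <= s by rewrite truncn_le ltW.
have sy : s < y.+1%:R by exact: truncnS_gt.
have wy : (w ^ 6 <= y)%N.
  rewrite truncn_ge_nat ?(ltW s0) // ler_pdivlMr // sx.
  have -> : l / 2 = 6%:R * (l / 16) + l / 8 by clear; lra.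
  rewrite expRD expRM_natl natrX; apply: ler_pM => //.
  by rewrite ler_pXn2r ?nnegrE ?expR_ge0.
have y0 : (0 < y)%N by apply: leq_trans wy; rewrite expn_gt0 ltnW.
have qyx : (q ^ 4 * y ^ 2)%:R < x.
  have qy : q%:R ^+ 2 * y%:R <= Num.sqrt x / 2.
    by move: ys; rewrite ler_pdivlMr //; clear; lra.
  rewrite expn4_2 natrX natrM natrX -(sqr_sqrtr (ltW x0)) ltr_pXn2r ?nnegrE ?sqrtr_ge0 //.
  by apply: le_lt_trans qy _; rewrite sx; have := expR_gt0 (l / 2); clear; lra.
have HS := counting_setS_ge HC C1 Cw wy (ltn0Sn _) stat qyx.
have rr : Num.sqrt l * Num.sqrt l = l by rewrite -expr2 sqr_sqrtr // ltW.
have rw : Num.sqrt l / 6 <= Num.sqrt (ln w%:R).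
  rewrite -(@ler_pXn2r _ 2) ?nnegrE ?divr_ge0 ?sqrtr_ge0 //.
  rewrite sqr_sqrtr; last exact: le_trans lnw22.
  by rewrite expr_div_n expr2 rr; clear -lnw_ge kl; lra.
rewrite -[_ * L1 ^+ 2 * _]mulrA.
apply: (combine_bounds (q := q%:R ^+ 2) (y := y%:R) (ly := ln y%:R) c00 C0 _ _ _ _ _ HS) => //.
- exact: exprn_gt0.
- by rewrite sqrtr_gt0.
- by rewrite mulr_gt0 // exprn_gt0.
- by apply: le_trans (Hc0 w w2); rewrite ler_pM2l.
- rewrite rr; apply: (@le_trans _ _ (l / 2)); last by clear -l0; lra.
  rewrite -[leRHS]expRK; apply: le_ln; rewrite ?ltr0n //; apply: le_trans ys _.
  rewrite -sx /s ler_pdivrMr // ler_peMr ?sqrtr_ge0 //. 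
  have : 1 <= q%:R ^+ 2 :> R by rewrite exprn_ege1 ?ler1n.
  by clear; lra.
- have : s <= 2 * y%:R.
    by apply: le_trans (ltW sy) _; rewrite -natr1 mulr_natl mulr2n lerD2l ler1n.
  by rewrite ler_pdivrMr //; clear; lra.
Qed.

Theorem mainTheorem1 (R : realType) :
  property_P setS /\
  asymp_gg (fun x : R => (counting_fun setS x)%:R)
    (fun x : R => Num.sqrt x /
       (Num.sqrt (ln x) * ln (ln x) ^+ 2 * ln (ln (ln x)) ^+ 2)).
Proof.
split; first exact: property_P_setS.
have [c c0 [T HT]] := setS_lower_bound R; exists c => //.
by apply: filterS (near_lnlnln T) => x [xT LT]; exact: HT.
Qed.
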